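(* Let $n\ge 3$, let $r=(r_1,\dots,r_n)$ be positive real numbers with $r_i<\sum_{j\ne i}r_j$ for all $i$, and put $|r|=\sum_i r_i$. For any triangulation $\Gamma$ of the reference $n$-gon $P$ there exists a completely integrable system $$\Psi_\Gamma:\mathrm{Gr}(2,n)\to\mathbb R^{2n-4}$$ which induces the bending system $\Phi_\Gamma:\mathcal M_r\to\mathbb R^{n-3}$ on the polygon space $\mathcal M_r$ through the symplectic reduction $\mathcal M_r\cong \mu_T^{-1}(2r)/T$ of $\mathrm{Gr}(2,n)$ by the maximal torus $T=T_{U(n)}$ of $U(n)$.
   Context: **Completely integrable system.** On a symplectic manifold of dimension $2N$: an $N$-tuple of real functions $(\varphi_1,\dots,\varphi_N)$, functionally independent (differentials linearly independent) on an open dense subset and mutually Poisson commutative. The functions are continuous and are only required to be smooth on an open dense subset, where the Poisson brackets are computed. **Grassmannian.** $\mathrm{Gr}(2,n)$ is the Grassmannian of 2-planes in $\mathbb C^n$, realized as the set of $n\times 2$ complex matrices with rows $(z_i,w_i)$ satisfying $\sum|z_i|^2=\sum|w_i|^2=2|r|$, $\sum z_i\overline{w}_i=0$, modulo the right action of $U(2)$; its symplectic form is the reduced form of the standard form on $\mathbb C^{n\times 2}$, equivalently the Kostant–Kirillov form on the (co)adjoint orbit of $\mathrm{diag}(|r|,|r|,0,\dots,0)$. $T=T_{U(n)}\subset U(n)$ is the torus of diagonal matrices acting by left multiplication, with moment map $\mu_T([z,w])=\big(\tfrac{|z_i|^2+|w_i|^2}{2}\big)_{i=1}^n$. **Polygon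 space.** $\mathcal M_r=\{(x_1,\dots,x_n)\in\prod_i S^2(r_i)\mid \sum_i x_i=0\}/SO(3)$, where $S^2(r_i)\subset\mathbb R^3$ is the sphere of radius $r_i$ centered at $0$. It is identified with the symplectic reduction $\mu_T^{-1}(2r)/T$ of $\mathrm{Gr}(2,n)$ by sending $[z,w]$ to $(x_i)$ with $x_i=\big(\tfrac12\mathrm{Re}(\overline z_iw_i),-\tfrac12\mathrm{Im}(\overline z_iw_i),\tfrac14(|z_i|^2-|w_i|^2)\big)$. **Triangulations and bending systems.** The reference $n$-gon $P$ is a fixed convex planar $n$-gon with sides $e_1,\dots,e_n$ in cyclic order. A triangulation $\Gamma$ of $P$ (with vertices those of $P$) is given by $n-3$ pairwise non-crossing diagonals $d_1,\dots,d_{n-3}$. Each $d_\alpha$ cuts the sides into two groups; let $I_\alpha\subset\{1,\dots,n\}$ be the index set of one of them (a choice of orientation, $d_\alpha=\sum_{i\in I_\alpha}e_i$). The bending system is $\Phi_\Gamma=(\varphi_{d_1},\dots,\varphi_{d_{n-3}})$ with $\varphi_{d_\alpha}(x)=\big|\sum_{i\in I_\alpha}x_i\big|$, the length of the corresponding diagonal. **Induces.** $\Psi_\Gamma$ induces $\Phi_\Gamma$ if $n-3$ of its components are $T$-invariant and their restrictions to $\mu_T^{-1}(2r)$ descend to functions on $\mathcal M_r$ equal to the components $\varphi_{d_\alpha}$ of $\Phi_\Gamma$ up to sign and additive constants. *)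

(* Defs.v *)
From HB Require Import structures.
From mathcomp Require Import all_boot all_order all_algebra.
From mathcomp Require Import sesquilinear spectral.
From mathcomp Require Import all_classical all_reals all_analysis.
From mathcomp Require Import complex.
From mathcomp Require Import ring.

Set Implicit Arguments.
Unset Strict Implicit.
Unset Printing Implicit Defensive.

Import Order.TTheory GRing.Theory Num.Theory.
Import numFieldNormedType.Exports.

Local Open Scope sesquilinear_scope.
Local Open Scope classical_set_scope.
Local Open Scope quotient_scope.
Local Open Scope ring_scope.
Local Open Scope complex_scope.

(* On a finite-dimensional [E] this is the usual notion: [F] is C^(k+1) on the
   open set [O] iff it is differentiable there and every directional
   derivative ['D_v F] is C^k.  [F] is total, but only its values on [O]
   matter. *)
Fixpoint Ck (R : realType) (E : normedModType R) (k : nat) (O : set E)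
    (F : E -> R) : Prop :=
  match k with
  | 0 => forall x, O x -> {for x, continuous F}
  | k'.+1 => (forall x, O x -> differentiable F x) /\
             (forall v : E, Ck k' O ('D_v F))
  end.

Definition smooth_on (R : realType) (E : normedModType R) (O : set E)
  (F : E -> R) : Prop := forall k, Ck k O F.

(* A complex [n x 2] matrix [X + iY] is carried by the pair [(X, Y)], so that
   the real normed space structure needed for calculus is the library's. *)
Notation cplane R n := ('M[R]_(n, 2) * 'M[R]_(n, 2))%type.

Definition sqmod (R : realType) (u : R[i]) : R := complex.Re u ^+ 2 + complex.Im u ^+ 2.

Section ComplexMatrices.
Context {R : realType} {n : nat}.
Implicit Types A V W : cplane R n.

Definition cmx A : 'M[R[i]]_(n, 2) := \matrix_(i, j) (A.1 i j +i* A.2 i j).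
Definition zc A (i : 'I_n) : R[i] := cmx A i 0.
Definition wc A (i : 'I_n) : R[i] := cmx A i 1.

(* The standard symplectic form, the sum of the [dx_ij /\ dy_ij]. *)
Definition sympl V W : R :=
  \sum_i \sum_j (V.1 i j * W.2 i j - V.2 i j * W.1 i j).

End ComplexMatrices.

Section Grassmannian.
Context {R : realType} {n : nat}.
Variable r : 'I_n -> R.

(* A level set of the moment map of the right action of U(2). *)
Definition stiefel : set (cplane R n) :=
  [set A | [/\ \sum_i sqmod (zc A i) = 2 * \sum_i r i,
               \sum_i sqmod (wc A i) = 2 * \sum_i r i &
               \sum_i zc A i * (wc A i)^* = 0]].

(* The kernel at [A] of the differential of the equations of [stiefel]; for
   [|r| > 0] these are independent along [stiefel] (U(2) acts freely), so that
   this is the tangent space of [stiefel] at [A]. *)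
Definition tangent (A : cplane R n) : set (cplane R n) :=
  [set V | [/\ \sum_i complex.Re ((zc A i)^* * zc V i) = 0,
               \sum_i complex.Re ((wc A i)^* * wc V i) = 0 &
               \sum_i (zc V i * (wc A i)^* + zc A i * (wc V i)^*) = 0]].

Definition U2_equiv (A B : stiefel) : Prop :=
  exists2 g : 'M[R[i]]_2, g \is unitarymx &
    cmx (val B) = cmx (val A) *m g.

Lemma U2_equiv_class : equiv_class_of (fun A B => `[< U2_equiv A B >]).
Proof.
have symm A B : U2_equiv A B -> U2_equiv B A.
  move=> [g gu e]; exists (g ^t*); first by rewrite trmxC_unitary.
  by rewrite e mulmxtVK.
split.
- move=> A; apply/asboolP; exists 1%:M; last by rewrite mulmx1.
  by apply/unitarymxP; rewrite trmx1 map_mx1 mulmx1.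
- by move=> A B; apply/asboolP/asboolP; exact: symm.
- move=> B A C /asboolP[g gu eg] /asboolP[h hu eh]; apply/asboolP.
  exists (g *m h); first exact: mul_unitarymx.
  by rewrite eh eg mulmxA.
Qed.

Definition U2_equiv_rel := EquivRelPack U2_equiv_class.

Definition Gr : topologicalType :=
  quotient_topology {eq_quot U2_equiv_rel}.

Definition Grpi (A : stiefel) : Gr := \pi_{eq_quot U2_equiv_rel} A.

(* Smooth functions, differentials and the reduced symplectic form of [Gr] are
   read on the total space [stiefel] of the U(2)-bundle [stiefel -> Gr]: the
   pullback of the reduced form is the restriction of [sympl] to [tangent A],
   whose kernel is tangent to the U(2)-orbit. *)

(* [F] is a smooth extension, to a neighbourhood of [A] in the space of all
   matrices, of the pullback of [f] to [stiefel]. *)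
Definition local_lift (f : Gr -> R) (A : stiefel) (F : cplane R n -> R)
    : Prop :=
  exists O : set (cplane R n),
    [/\ open O, O (val A), smooth_on O F &
        forall B : stiefel, O (val B) -> F (val B) = f (Grpi B)].

Definition smooth_on_Gr (U : set Gr) (f : Gr -> R) : Prop :=
  forall A : stiefel, U (Grpi A) -> exists F, local_lift f A F.

(* [X] is tangent to [stiefel] and lifts the Hamiltonian vector at [Grpi A] of
   the function of which [F] is a [local_lift]; it is determined up to vectors
   tangent to the U(2)-orbit. *)
Definition hamiltonian_at (A : stiefel) (F : cplane R n -> R)
    (X : cplane R n) : Prop :=
  tangent (val A) X /\
  forall V, tangent (val A) V -> sympl X V = 'D_V F (val A).

(* {f, g}(Grpi A) = c *)
Definition poisson_bracket_at (f g : Gr -> R) (A : stiefel) (c : R) : Prop :=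
  exists F G X Y,
    [/\ local_lift f A F, local_lift g A G,
        hamiltonian_at A F X, hamiltonian_at A G Y & c = sympl X Y].

(* The differentials of the [f k] at [Grpi A] are linearly independent. *)
Definition independent_at (N : nat) (f : 'I_N -> Gr -> R) (A : stiefel)
    : Prop :=
  exists F : 'I_N -> cplane R n -> R,
    (forall k, local_lift (f k) A (F k)) /\
    forall c : 'I_N -> R,
      (forall V, tangent (val A) V -> \sum_k c k * 'D_V (F k) (val A) = 0) ->
      forall k, c k = 0.

(* [N] is meant to be half the real dimension of [Gr], namely [2 * n - 4]. *)
Definition completely_integrable (N : nat) (Psi : Gr -> 'rV[R]_N) : Prop :=
  let psi k p := Psi p 0 k in
  continuous Psi /\
  exists U : set Gr,
    [/\ open U, dense U, forall k, smooth_on_Gr U (psi k),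
        forall j k (A : stiefel), U (Grpi A) ->
          poisson_bracket_at (psi j) (psi k) A 0 &
        exists V : set Gr,
          [/\ open V, dense V, V `<=` U &
              forall A : stiefel, V (Grpi A) -> independent_at psi A]].

Definition T_equiv (A B : stiefel) : Prop :=
  exists t : 'rV[R[i]]_n,
    (forall i, `|t 0 i| = 1) /\ cmx (val B) = diag_mx t *m cmx (val A).

Definition T_invariant (f : Gr -> R) : Prop :=
  forall A B : stiefel, T_equiv A B -> f (Grpi A) = f (Grpi B).

Definition muT (A : cplane R n) (i : 'I_n) : R :=
  (sqmod (zc A i) + sqmod (wc A i)) / 2.

Definition enorm (x : 'rV[R]_3) : R := Num.sqrt (\sum_k x 0 k ^+ 2).

(* The i-th row of the matrix is the i-th edge vector. *)
Definition closed_polygons : set 'M[R]_(n, 3) :=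
  [set x | (forall i, enorm (row i x) = r i) /\ \sum_i row i x = 0].

Definition SO3_equiv (x y : closed_polygons) : Prop :=
  exists g : 'M[R]_3,
    [/\ g *m g^T = 1%:M, \det g = 1 & val y = val x *m g].

Lemma SO3_equiv_class : equiv_class_of (fun x y => `[< SO3_equiv x y >]).
Proof.
have symm x y : SO3_equiv x y -> SO3_equiv y x.
  move=> [g [go gd e]]; exists (g^T); split.
  - by rewrite trmxK; exact: mulmx1C.
  - by rewrite det_tr.
  - by rewrite e -mulmxA go mulmx1.
split.
- move=> x; apply/asboolP; exists 1%:M.
  by rewrite trmx1 !mulmx1 det1.
- by move=> x y; apply/asboolP/asboolP; exact: symm.
- move=> y x z /asboolP[g [go gd eg]] /asboolP[h [ho hd eh]]; apply/asboolP.
  exists (g *m h); split.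
  - by rewrite trmx_mul mulmxA -(mulmxA g) ho mulmx1.
  - by rewrite det_mulmx gd hd mulr1.
  - by rewrite eh eg mulmxA.
Qed.

Definition SO3_equiv_rel := EquivRelPack SO3_equiv_class.

Definition polygon_space : Type := {eq_quot SO3_equiv_rel}.

Definition polpi (x : closed_polygons) : polygon_space :=
  \pi_{eq_quot SO3_equiv_rel} x.

Definition bending (I : {set 'I_n}) (p : polygon_space) : R :=
  enorm (\sum_(i in I) row i (val (repr (p : {eq_quot SO3_equiv_rel})))).

Lemma enormM (g : 'M[R]_3) (x : 'rV[R]_3) :
  g *m g^T = 1%:M -> enorm (x *m g) = enorm x.
Proof.
move=> go; have sqE (y : 'rV[R]_3) : \sum_k y 0 k ^+ 2 = (y *m y^T) 0 0.
  by rewrite mxE; apply: eq_bigr => k _; rewrite mxE expr2.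
by rewrite /enorm !sqE trmx_mul mulmxA -(mulmxA x) go mulmx1.
Qed.

Lemma bendingE (I : {set 'I_n}) (x : closed_polygons) :
  bending I (polpi x) = enorm (\sum_(i in I) row i (val x)).
Proof.
rewrite /bending /polpi; case: piP => y /eqmodP/asboolP[g [go _ e]].
rewrite e -[in RHS](enormM _ go) mulmx_suml; congr enorm.
by apply: eq_bigr => i _; rewrite row_mul.
Qed.

Definition edges (A : cplane R n) : 'M[R]_(n, 3) :=
  \matrix_(i, k) [:: complex.Re ((zc A i)^* * wc A i) / 2;
                     - complex.Im ((zc A i)^* * wc A i) / 2;
                     (sqmod (zc A i) - sqmod (wc A i)) / 4]`_k.

Definition muT_level : set stiefel :=
  [set A | forall i, muT (val A) i = 2 * r i].

Lemma edges_closed (A : stiefel) :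
  muT_level A -> closed_polygons (edges (val A)).
Proof.
move=> hA; have [sz sw szw] := set_mem (valP A); rewrite /muT_level /= in hA.
set B := val A in hA sz sw szw *.
split=> [i|].
- have ri : (sqmod (zc B i) + sqmod (wc B i)) / 4 = r i.
    have -> : r i = (2 * r i) / 2 by field.
    by rewrite -hA /muT; field.
  rewrite /enorm !big_ord_recl big_ord0 !mxE /= -ri.
  set s := (X in Num.sqrt X).
  have -> : s = ((sqmod (zc B i) + sqmod (wc B i)) / 4) ^+ 2.
    rewrite /s /sqmod; case: (zc B i) (wc B i) => a b [c d] /=.
    by field.
  by rewrite sqrtr_sqr ger0_norm // divr_ge0 // !addr_ge0 // ?sqr_ge0.
- have swz : \sum_i (zc B i)^* * wc B i = 0.
    have := congr1 Num.conj szw; rewrite rmorph0 rmorph_sum /= => szwC.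
    rewrite -[RHS]szwC.
    by apply: eq_bigr => i _; rewrite rmorphM /= conjCK.
  apply/rowP => k; rewrite summxE.
  have -> : \sum_i row i (edges B) 0 k = \sum_i edges B i k.
    by apply: eq_bigr => i _; rewrite mxE.
  rewrite [RHS]mxE.
  case: k => -[|[|[|//]]] hk; under eq_bigr do rewrite mxE /=.
  + by rewrite -mulr_suml -(raddf_sum (@complex.Re R : Rcomplex R -> R)) swz mul0r.
  + by rewrite -mulr_suml sumrN -(raddf_sum (@complex.Im R : Rcomplex R -> R)) swz oppr0 mul0r.
  + by rewrite -mulr_suml sumrB sz sw subrr mul0r.
Qed.

Definition polygon_of (A : stiefel) (hA : muT_level A) : polygon_space :=
  polpi (exist _ (edges (val A)) (mem_set (edges_closed hA))).

(* The restriction of [f] to the level set of the torus moment map is the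
   pullback of [h] under the quotient map of the reduction. *)
Definition descends_to (f : Gr -> R) (h : polygon_space -> R) : Prop :=
  forall (A : stiefel) (hA : muT_level A), f (Grpi A) = h (polygon_of hA).

(* [I a] is the set of sides defining the a-th bending Hamiltonian. *)
Definition induces (m N : nat) (Psi : Gr -> 'rV[R]_N)
    (I : 'I_m -> {set 'I_n}) : Prop :=
  exists s : 'I_m -> 'I_N,
    injective s /\
    forall a : 'I_m,
      T_invariant (fun p => Psi p 0 (s a)) /\
      exists (e : bool) (c : R),
        descends_to (fun p => Psi p 0 (s a))
                    (fun x => (-1) ^+ e * bending (I a) x + c).

End Grassmannian.

(* The vertices of the convex n-gon are labelled in cyclic order by ['I_n], the
   side [e_i] joining [i] to [i + 1] modulo [n].  A diagonal is the pair of its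
   endpoints, smaller one first.  In a convex polygon two diagonals meet in
   their interiors exactly when their endpoints interleave. *)
Definition is_diagonal (n : nat) (d : 'I_n * 'I_n) : bool :=
  (d.1.+1 < d.2)%N && ~~ ((d.1 == 0 :> nat) && (d.2.+1 == n)).

Definition crossing (n : nat) (d d' : 'I_n * 'I_n) : bool :=
  [|| [&& d.1 < d'.1, d'.1 < d.2 & d.2 < d'.2] |
      [&& d'.1 < d.1, d.1 < d'.2 & d'.2 < d.2]]%N.

Record triangulation (n : nat) := Triangulation {
  diagonals :> 'I_(n - 3) -> 'I_n * 'I_n;
  diagonalsP : forall a, is_diagonal (diagonals a);
  diagonals_inj : injective diagonals;
  diagonals_noncrossing : forall a b, ~~ crossing (diagonals a) (diagonals b)
}.

(* The sides on one of the two sides of the diagonal. *)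
Definition cut_sides (n : nat) (d : 'I_n * 'I_n) : {set 'I_n} :=
  [set i : 'I_n | (d.1 <= i < d.2)%N].

Definition side_choice (n : nat) (Gamma : triangulation n)
    (I : 'I_(n - 3) -> {set 'I_n}) : Prop :=
  forall a, I a = cut_sides (Gamma a) \/ I a = ~: cut_sides (Gamma a).

(* Main.v *)
(** The bending Hamiltonians of the diagonals lift to the lengths of the partial
    sums [chord I A] of the edge vectors on all of Gr(2, n), where the perimeter,
    not the single side lengths, is fixed. Together with all but one of the
    components of the torus moment map they form the system. The flow of each
    function rotates the rows of [A] by elements of u(2), one per row; as the
    index sets of non-crossing diagonals are nested or disjoint, these fields
    are symplectically orthogonal.
    For independence, a vanishing combination of the differentials is, by
    Lagrange multipliers, a rotation of all the rows by the same element of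
    u(2). Where chords of disjoint index sets are never parallel, going up the
    laminar family forces the coefficients to vanish. Such points are dense: a
    polynomial perturbation followed by Gram-Schmidt makes any two chords
    non-parallel. *)

Require Import Defs.
From HB Require Import structures.
From mathcomp Require Import all_boot all_order all_algebra.
From mathcomp Require Import sesquilinear spectral.
From mathcomp Require Import all_classical all_reals all_analysis.
From mathcomp Require Import complex.
From mathcomp Require Import ring lra.

Set Implicit Arguments.
Unset Strict Implicit.
Unset Printing Implicit Defensive.

Import Order.TTheory GRing.Theory Num.Theory.
Import numFieldNormedType.Exports.

Local Open Scope classical_set_scope.
Local Open Scope ring_scope.

(** The moment and the edge of a row are, up to normalisation, the trace and the traceless part of
    one Hermitian 2 by 2 matrix, the moment map of U(2) acting on that row. This turns the
    symplectic questions into vector algebra in R^3: Hamiltonian fields are row rotations, their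
    pairings are triple products, and [stiefel] says only that the edges sum to zero and the moments
    to [2 * \sum_i r i]. A length is not smooth where its chord vanishes, and the independence
    argument needs non-parallel chords; the single set [generic] secures both. It depends on [A]
    only through the Gram matrix of its rows, so it descends to [Gr]. Density meets an obstacle:
    polynomial perturbations leave [stiefel], and Gram-Schmidt is not polynomial. Parallelism is
    therefore tested by determinants of Gram forms, which transform explicitly under the triangular
    correction. Each diagonal is represented by the side group that avoids the last side. These
    groups sit in one tree rooted at the set of all other sides, and the last moment is the one left
    out; its absence removes the common phase at the end. *)

(** * Calculus of C^k functions on an open set *)

Section SmoothFunctions.
Context {R : realType} {E : normedModType R}.
Implicit Types (k : nat) (O : set E) (F G : E -> R).

(** The first-order expansion of [F] at [x] is also one of [G], and such an expansion determines the
    differential. *)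
Lemma near_eq_differentiable F G (x : E) : {near x, F =1 G} ->
  differentiable F x -> differentiable G x.
Proof.
move=> FG dF; have FGx : F x = G x := nbhs_singleton FG.
have loc : G \o shift x = cst (G x) + 'd F x +o_ 0 id.
  apply/eqaddoP => e e0; have /eqaddoP/(_ e e0) := diff_locally dF.
  have : \forall h \near 0, F (h + x) = G (h + x).
    by move: FG; rewrite (near_shift 0 x) subr0.
  apply: filterS2 => h FGh; congr (`|_| <= _).
  by rewrite !fctE /= -FGx -FGh.
have dG := diff_unique (diff_continuous dF) loc.
by apply/diff_locallyP; rewrite dG; split=> //; exact: diff_continuous.
Qed.

(** This allows a derivative to be replaced by a formula that is valid on [O] only, as for inverses
    and square roots. *)
Lemma Ck_ext k O F G : open O -> (forall x, O x -> F x = G x) ->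
  Ck k O F -> Ck k O G.
Proof.
move=> Oo; elim: k F G => [|k IH] F G FG /=.
  move=> cF x Ox; have nO : nbhs x O by apply: open_nbhs_nbhs.
  rewrite /prop_for /continuous_at -(FG _ Ox); apply: cvg_trans (cF _ Ox).
  by apply: near_eq_cvg; apply: filterS nO => y Oy; rewrite FG.
move=> [dF cF]; split=> [x Ox|v].
  have nO : nbhs x O by apply: open_nbhs_nbhs.
  have FGx : {near x, F =1 G} by apply: filterS nO => y Oy; rewrite FG.
  exact: near_eq_differentiable FGx (dF _ Ox).
apply: IH (cF v) => x Ox; case: (eqVneq v 0) => [->|v0]; first by rewrite !derive0.
apply: near_eq_derive => //.
by have nO : nbhs x O by [apply: open_nbhs_nbhs]; apply: filterS nO => y; exact: FG.
Qed.

Lemma Ck_continuous k O F : Ck k O F -> forall x, O x -> {for x, continuous F}.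
Proof.
case: k => [//|k] [dF _] x Ox; exact: differentiable_continuous (dF _ Ox).
Qed.

Lemma CkW k O F : Ck k.+1 O F -> Ck k O F.
Proof.
elim: k F => [|k IH] F cF; first exact: Ck_continuous cF.
by split; [exact: cF.1|move=> v; apply: IH; exact: cF.2].
Qed.

Lemma Ck_cst k O (c : R) : Ck k O (fun=> c).
Proof.
elim: k c => [|k IH] c /=; first by move=> x _; exact: cst_continuous.
split=> [x _|v]; first exact: differentiable_cst.
by have -> : 'D_v (fun=> c) = fun=> 0 :> R by apply/funext => x; rewrite derive_cst.
Qed.

Lemma Ck_linear k O (f : {linear E -> R}) : continuous f -> Ck k O f.
Proof.
move=> fc; case: k => [|k]; first by move=> x _; exact: fc.
split=> [x _|v]; first exact: linear_differentiable.
have -> : 'D_v f = fun=> f v; last exact: Ck_cst.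
by apply/funext => x; rewrite deriveE ?diff_lin//; exact: linear_differentiable.
Qed.

Lemma CkD k O F G : open O -> Ck k O F -> Ck k O G -> Ck k O (fun x => F x + G x).
Proof.
move=> Oo; elim: k F G => [|k IH] F G cF cG.
  by move=> x Ox; apply: continuousD; [exact: cF|exact: cG].
split=> [x Ox|v]; first by apply: differentiableD; [exact: cF.1|exact: cG.1].
apply: Ck_ext (IH _ _ (cF.2 v) (cG.2 v)) => // x Ox.
by rewrite deriveD//; apply: diff_derivable; [exact: cF.1|exact: cG.1].
Qed.

Lemma CkM k O F G : open O -> Ck k O F -> Ck k O G -> Ck k O (fun x => F x * G x).
Proof.
move=> Oo; elim: k F G => [|k IH] F G cF cG.
  by move=> x Ox; apply: continuousM; [exact: cF|exact: cG].
split=> [x Ox|v]; first by apply: differentiableM; [exact: cF.1|exact: cG.1].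
have cFG := IH _ _ (CkW cF) (cG.2 v); have cGF := IH _ _ (CkW cG) (cF.2 v).
apply: Ck_ext (CkD Oo cFG cGF) => // x Ox.
by rewrite deriveM//; apply: diff_derivable; [exact: cF.1|exact: cG.1].
Qed.

Lemma Ck_sum k O (J : Type) (s : seq J) (P : pred J) (F : J -> E -> R) : open O ->
  (forall j, Ck k O (F j)) -> Ck k O (fun x => \sum_(j <- s | P j) F j x).
Proof.
move=> Oo cF; elim: s => [|j s IH].
  by under eq_fun do rewrite big_nil; exact: Ck_cst.
under eq_fun do rewrite big_cons; case: (P j) => //.
exact: CkD.
Qed.

(** The derivative is a product of [F^-1] twice and a derivative of [F], so the induction on [k]
    feeds on itself; [Ck_sqrt] follows the same scheme. *)
Lemma CkV k O F : open O -> (forall x, O x -> F x != 0) ->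
  Ck k O F -> Ck k O (fun x => (F x)^-1).
Proof.
move=> Oo F0; elim: k => [|k IH] cF.
  by move=> x Ox; apply: continuousV; [exact: F0|exact: cF].
split=> [x Ox|v]; first by apply: differentiableV; [exact: cF.1|exact: F0].
have cV := IH (CkW cF).
apply: Ck_ext (CkM Oo (Ck_cst _ _ (-1)) (CkM Oo (CkM Oo cV cV) (cF.2 v))) => // x Ox.
rewrite deriveV ?F0//; last by apply: diff_derivable; exact: cF.1.
by rewrite mulN1r -expr2 exprVn -mulNr.
Qed.

Lemma differentiable_sqrt F x : 0 < F x -> differentiable F x ->
  differentiable (Num.sqrt \o F) x.
Proof.
move=> Fx dF; apply: differentiable_comp => //.
by apply/derivable1_diffP; have [] := is_derive1_sqrt Fx.
Qed.

Lemma derive_sqrt_comp F x v : 0 < F x -> differentiable F x ->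
  'D_v (Num.sqrt \o F) x = (2 * Num.sqrt (F x))^-1 * 'D_v F x.
Proof.
move=> Fx dF; rewrite (deriveE _ dF) deriveE; last exact: differentiable_sqrt.
have [dS vS] := is_derive1_sqrt Fx.
have dS' : differentiable (@Num.sqrt R) (F x) by exact/derivable1_diffP.
apply: etrans (congr1 (@^~ v) (diff_comp dF dS')) _.
by rewrite [LHS]/= (diff1E dS') derive1E vS [LHS]mulrC.
Qed.

Lemma Ck_sqrt k O F : open O -> (forall x, O x -> 0 < F x) ->
  Ck k O F -> Ck k O (Num.sqrt \o F).
Proof.
move=> Oo F0; elim: k => [|k IH] cF.
  by move=> x Ox; apply: continuous_comp; [exact: cF|exact: sqrt_continuous].
split=> [x Ox|v]; first by apply: differentiable_sqrt; [exact: F0|exact: cF.1].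
have cS := CkM Oo (Ck_cst _ _ 2) (IH (CkW cF)).
have cV : Ck k O (fun x => (2 * Num.sqrt (F x))^-1).
  by apply: CkV cS => // x Ox /=; rewrite mulf_neq0 ?pnatr_eq0// gt_eqF// sqrtr_gt0 F0.
apply: Ck_ext (CkM Oo cV (cF.2 v)) => // x Ox.
by rewrite derive_sqrt_comp ?F0//; exact: cF.1.
Qed.

End SmoothFunctions.

(** * Vector algebra in R^3 *)

Lemma sum_ord2 (R : nmodType) (F : 'I_2 -> R) : \sum_j F j = F 0 + F 1.
Proof.
by rewrite !big_ord_recl big_ord0 addr0; congr (_ + F _); exact: val_inj.
Qed.

Lemma sum_ord3 (R : nmodType) (F : 'I_3 -> R) : \sum_j F j = F 0 + F 1 + F 2.
Proof.
rewrite !big_ord_recl big_ord0 addr0 addrA.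
by congr (_ + F _ + F _); exact: val_inj.
Qed.

Section Vectors3.
Context {R : realType}.
Implicit Types u v w x y : 'rV[R]_3.

Definition vec3 (a b c : R) : 'rV[R]_3 := \row_k [:: a; b; c]`_k.

Lemma vec3E a b c :
  (vec3 a b c 0 0 = a) * (vec3 a b c 0 1 = b) * (vec3 a b c 0 2 = c).
Proof. by rewrite !mxE. Qed.

Lemma eq_vec3 u v : u 0 0 = v 0 0 -> u 0 1 = v 0 1 -> u 0 2 = v 0 2 -> u = v.
Proof.
move=> e0 e1 e2; apply/rowP => -[[|[|[|//]]] hk].
- by rewrite (_ : Ordinal hk = 0)//; exact: val_inj.
- by rewrite (_ : Ordinal hk = 1)//; exact: val_inj.
- by rewrite (_ : Ordinal hk = 2)//; exact: val_inj.
Qed.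

Definition dot u v : R := \sum_k u 0 k * v 0 k.

Lemma dotE u v : dot u v = u 0 0 * v 0 0 + u 0 1 * v 0 1 + u 0 2 * v 0 2.
Proof. exact: sum_ord3. Qed.

Definition cross u v : 'rV[R]_3 :=
  vec3 (u 0 1 * v 0 2 - u 0 2 * v 0 1)
       (u 0 2 * v 0 0 - u 0 0 * v 0 2)
       (u 0 0 * v 0 1 - u 0 1 * v 0 0).

Lemma dotC u v : dot u v = dot v u.
Proof. by apply: eq_bigr => k _; rewrite mulrC. Qed.

Lemma dotDl u v w : dot (u + v) w = dot u w + dot v w.
Proof. by rewrite /dot -big_split; apply: eq_bigr => k _; rewrite mxE mulrDl. Qed.

Lemma dotZl a u v : dot (a *: u) v = a * dot u v.
Proof. by rewrite /dot mulr_sumr; apply: eq_bigr => k _; rewrite mxE mulrA. Qed.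

Lemma dotZr a u v : dot u (a *: v) = a * dot u v.
Proof. by rewrite dotC dotZl dotC. Qed.

Lemma dot0l v : dot 0 v = 0.
Proof. by rewrite -(scale0r 0) dotZl mul0r. Qed.

Lemma dot0r v : dot v 0 = 0. Proof. by rewrite dotC dot0l. Qed.

Lemma dot_suml (J : Type) (s : seq J) (P : pred J) (F : J -> 'rV[R]_3) v :
  dot (\sum_(j <- s | P j) F j) v = \sum_(j <- s | P j) dot (F j) v.
Proof.
by apply: (big_morph (fun u => dot u v)) => [u w|]; rewrite ?dotDl ?dot0l.
Qed.

Lemma dot_sumr (J : Type) (s : seq J) (P : pred J) (F : J -> 'rV[R]_3) v :
  dot v (\sum_(j <- s | P j) F j) = \sum_(j <- s | P j) dot v (F j).
Proof. by rewrite dotC dot_suml; apply: eq_bigr => j _; rewrite dotC. Qed.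

Lemma crossC u v : cross u v = - cross v u.
Proof. by apply: eq_vec3; rewrite !mxE /=; ring. Qed.

Lemma crossDl u v w : cross (u + v) w = cross u w + cross v w.
Proof. by apply: eq_vec3; rewrite !mxE /=; ring. Qed.

Lemma crossZl a u v : cross (a *: u) v = a *: cross u v.
Proof. by apply: eq_vec3; rewrite !mxE /=; ring. Qed.

Lemma crossZr a u v : cross u (a *: v) = a *: cross u v.
Proof. by rewrite crossC crossZl crossC scalerN opprK. Qed.

Lemma cross0l v : cross 0 v = 0.
Proof. by apply: eq_vec3; rewrite !mxE /=; ring. Qed.

Lemma cross0r v : cross v 0 = 0. Proof. by rewrite crossC cross0l oppr0. Qed.

Lemma crossuu u : cross u u = 0.
Proof. by apply: eq_vec3; rewrite !mxE /=; ring. Qed.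

Lemma cross_suml (J : Type) (s : seq J) (P : pred J) (F : J -> 'rV[R]_3) v :
  cross (\sum_(j <- s | P j) F j) v = \sum_(j <- s | P j) cross (F j) v.
Proof.
by apply: (big_morph (fun u => cross u v)) => [u w|]; rewrite ?crossDl ?cross0l.
Qed.

Lemma dot_crossl u v : dot u (cross u v) = 0.
Proof. by rewrite dotE !mxE /=; ring. Qed.

Lemma enormE u : enorm u = Num.sqrt (dot u u).
Proof. by rewrite /enorm; congr Num.sqrt; apply: eq_bigr => k _; rewrite expr2. Qed.

Lemma dot_ge0 u : 0 <= dot u u.
Proof. by apply: sumr_ge0 => k _; rewrite -expr2 sqr_ge0. Qed.

Lemma dot_eq0 u : dot u u = 0 -> u = 0.
Proof.
move=> /eqP; rewrite psumr_eq0 => [/allP e|k _]; last by rewrite -expr2 sqr_ge0.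
apply/rowP => k; rewrite mxE; apply/eqP.
by have := e k (mem_index_enum k); rewrite mulf_eq0 orbb.
Qed.

Lemma dot_gt0 u : u != 0 -> 0 < dot u u.
Proof.
by move=> u0; rewrite lt_neqAle dot_ge0 andbT eq_sym; apply: contraNneq u0 => /dot_eq0 ->.
Qed.

Lemma enorm_gt0 u : u != 0 -> 0 < enorm u.
Proof. by move=> u0; rewrite enormE sqrtr_gt0 dot_gt0. Qed.

Lemma enormN u : enorm (- u) = enorm u.
Proof. by rewrite !enormE -scaleN1r dotZl dotZr mulrA mulrNN mulr1 mul1r. Qed.

(** If [s] were nonzero, [x] and [y] would both be multiples of it, by the expansion of the double
    cross product, and hence parallel. *)
Lemma cross_eq0_common s x y :
  cross s x = 0 -> cross s y = 0 -> cross x y != 0 -> s = 0.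
Proof.
move=> sx sy; apply: contra_neq_eq => s0.
have dss : dot s s != 0 by rewrite gt_eqF// dot_gt0.
have tripl : dot s s *: cross x y = 0.
  have e u : dot s s *: u = dot s u *: s - cross s (cross s u).
    by apply: eq_vec3; rewrite !mxE !dotE /=; ring.
  have ex : dot s s *: x = dot s x *: s by rewrite e sx cross0r subr0.
  have ey : dot s s *: y = dot s y *: s by rewrite e sy cross0r subr0.
  by rewrite -crossZl ex crossZl sy scaler0.
by move/eqP: tripl; rewrite scaler_eq0 (negPf dss) => /eqP.
Qed.

End Vectors3.

(** * Edges and infinitesimal unitary motions of the rows *)

Section RowRotations.
Context {R : realType} {n : nat}.
Implicit Types (A V W : cplane R n) (h : 'I_n -> R) (v : 'I_n -> 'rV[R]_3).

Definition edge A i : 'rV[R]_3 := row i (edges A).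

Lemma edgeE A i : edge A i = vec3
  ((A.1 i 0 * A.1 i 1 + A.2 i 0 * A.2 i 1) / 2)
  (- (A.1 i 0 * A.2 i 1 - A.2 i 0 * A.1 i 1) / 2)
  ((A.1 i 0 ^+ 2 + A.2 i 0 ^+ 2 - A.1 i 1 ^+ 2 - A.2 i 1 ^+ 2) / 4).
Proof.
apply: eq_vec3; rewrite !mxE /= /zc /wc /cmx /sqmod !mxE /=.
- by congr (_ / _); ring.
- by congr (- _ / _); ring.
- by congr (_ / _); ring.
Qed.

Definition chord (I : {set 'I_n}) A : 'rV[R]_3 := \sum_(i in I) edge A i.

(* [dmuT A V] and [dedge A V] are the differentials at [A] of [muT] and [edge],
   applied to [V]. *)
Definition dmuT A V i : R :=
  A.1 i 0 * V.1 i 0 + A.2 i 0 * V.2 i 0 + A.1 i 1 * V.1 i 1 + A.2 i 1 * V.2 i 1.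

Definition dedge A V i : 'rV[R]_3 := vec3
  ((A.1 i 0 * V.1 i 1 + V.1 i 0 * A.1 i 1 + A.2 i 0 * V.2 i 1 + V.2 i 0 * A.2 i 1) / 2)
  (- (A.1 i 0 * V.2 i 1 + V.1 i 0 * A.2 i 1 - A.2 i 0 * V.1 i 1 - V.2 i 0 * A.1 i 1) / 2)
  ((A.1 i 0 * V.1 i 0 + A.2 i 0 * V.2 i 0 - A.1 i 1 * V.1 i 1 - A.2 i 1 * V.2 i 1) / 2).

Definition dchord (I : {set 'I_n}) A V : 'rV[R]_3 := \sum_(i in I) dedge A V i.

(* The Hamiltonian vector at [A] of [\sum_i (h i * muT i + dot (v i) (edge i))]:
   it moves each row of [A] by an infinitesimal unitary of its own. *)
Definition row_rot h v A : cplane R n :=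
  (\matrix_(i, j) [:: h i * A.2 i 0 + v i 0 0 * A.2 i 1 / 2 +
                        v i 0 1 * A.1 i 1 / 2 + v i 0 2 * A.2 i 0 / 2;
                      h i * A.2 i 1 + v i 0 0 * A.2 i 0 / 2 -
                        v i 0 1 * A.1 i 0 / 2 - v i 0 2 * A.2 i 1 / 2]`_j,
   \matrix_(i, j) [:: - h i * A.1 i 0 - v i 0 0 * A.1 i 1 / 2 +
                        v i 0 1 * A.2 i 1 / 2 - v i 0 2 * A.1 i 0 / 2;
                      - h i * A.1 i 1 - v i 0 0 * A.1 i 0 / 2 -
                        v i 0 1 * A.2 i 0 / 2 + v i 0 2 * A.1 i 1 / 2]`_j).

Lemma sympl_row_rot h v A V :
  sympl (row_rot h v A) V = \sum_i (h i * dmuT A V i + dot (v i) (dedge A V i)).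
Proof.
by apply: eq_bigr => i _; rewrite sum_ord2 dotE /dmuT /dedge !vec3E !mxE /=; field.
Qed.

Lemma dmuT_rot h v A i : dmuT A (row_rot h v A) i = 0.
Proof. by rewrite /dmuT !mxE /=; field. Qed.

(** The edge is the image of the row under a Hopf map, which intertwines u(2) with so(3): the phase
    [h] is lost and [v] becomes an axis of rotation. *)
Lemma dedge_rot h v A i : dedge A (row_rot h v A) i = cross (edge A i) (v i).
Proof.
by rewrite edgeE; apply: eq_vec3; rewrite /dedge /cross !vec3E !mxE /=; field.
Qed.

Lemma sympl_rotrot h v h' v' A :
  sympl (row_rot h v A) (row_rot h' v' A) = \sum_i dot (v i) (cross (edge A i) (v' i)).
Proof.
rewrite sympl_row_rot; apply: eq_bigr => i _.
by rewrite dmuT_rot dedge_rot mulr0 add0r.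
Qed.

(** The four real equations of [stiefel] regroup into one for the total moment and three for the
    closing of the polygon; here is the linearised form. *)
Lemma tangentP A V : tangent A V <->
  \sum_i dmuT A V i = 0 /\ \sum_i dedge A V i = 0.
Proof.
pose a i := A.1 i 0 * V.1 i 0 + A.2 i 0 * V.2 i 0.
pose b i := A.1 i 1 * V.1 i 1 + A.2 i 1 * V.2 i 1.
pose c i := A.1 i 0 * V.1 i 1 + V.1 i 0 * A.1 i 1 + A.2 i 0 * V.2 i 1 + V.2 i 0 * A.2 i 1.
pose d i := A.1 i 0 * V.2 i 1 + V.1 i 0 * A.2 i 1 - A.2 i 0 * V.1 i 1 - V.2 i 0 * A.1 i 1.
have -> : \sum_i dmuT A V i = \sum_i a i + \sum_i b i.
  by rewrite -big_split; apply: eq_bigr => i _ /=; rewrite /dmuT /a /b addrA.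
have -> : \sum_i dedge A V i =
    vec3 ((\sum_i c i) / 2) (- (\sum_i d i) / 2) ((\sum_i a i - \sum_i b i) / 2).
  rewrite -sumrB -!sumrN !mulr_suml; apply: eq_vec3; rewrite summxE !vec3E.
  - by apply: eq_bigr => i _; rewrite vec3E.
  - by apply: eq_bigr => i _; rewrite vec3E.
  - by apply: eq_bigr => i _; rewrite vec3E /a /b; congr (_ / _); ring.
rewrite /tangent /=.
have -> : \sum_i complex.Re ((zc A i)^* * zc V i) = \sum_i a i.
  by apply: eq_bigr => i _; rewrite /zc /cmx !mxE /= mulNr opprK.
have -> : \sum_i complex.Re ((wc A i)^* * wc V i) = \sum_i b i.
  by apply: eq_bigr => i _; rewrite /wc /cmx !mxE /= mulNr opprK.
have -> : \sum_i (zc V i * (wc A i)^* + zc A i * (wc V i)^*) =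
    ((\sum_i c i) +i* (- \sum_i d i))%C.
  apply/eqP; rewrite eq_complex /= -sumrN; apply/andP; split; apply/eqP.
    rewrite (raddf_sum (@complex.Re R : Rcomplex R -> R)).
    by apply: eq_bigr => i _; rewrite /zc /wc /cmx !mxE /= /c; ring.
  rewrite (raddf_sum (@complex.Im R : Rcomplex R -> R)).
  by apply: eq_bigr => i _; rewrite /zc /wc /cmx !mxE /= /d; ring.
split=> [[-> -> [-> /eqP]]|[e1 e2]].
  rewrite oppr_eq0 => /eqP ->; rewrite addr0 subrr oppr0 !mul0r; split=> //.
  by apply: eq_vec3; rewrite vec3E mxE.
have e k : vec3 ((\sum_i c i) / 2) (- (\sum_i d i) / 2)
   ((\sum_i a i - \sum_i b i) / 2) 0 k = 0 by rewrite e2 mxE.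
have := e 0; have := e 1; have := e 2; rewrite !vec3E => ek2 ek1 ek0.
have -> : \sum_i c i = 0 by lra.
have -> : \sum_i d i = 0 by lra.
by rewrite oppr0; split=> //; lra.
Qed.

End RowRotations.

(** * Derivatives of moments and chord lengths, and their Hamiltonian fields *)

(** Degree four suffices: edges are quadratic in the entries of the matrix, so squared chord lengths
    are quartic along lines, and the derivative is the linear coefficient. *)
Lemma derive_quartic (R : realType) (E : normedModType R) (F : E -> R) (x v : E)
    (l a b c : R) :
  (forall t, F (t *: v + x) = F x + t * (l + t * (a + t * (b + t * c)))) ->
  'D_v F x = l.
Proof.
move=> e; apply/cvg_lim => //=.
apply: (@cvg_trans _ ((fun t : R => l + t * (a + t * (b + t * c))) @ 0^')).
  apply: near_eq_cvg; near=> t.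
  have t0 : t != 0 by near: t; exact: nbhs_dnbhs_neq.
  by rewrite /= e addrAC subrr add0r /GRing.scale /= mulKf.
apply: cvg_within_filter.
suff : {for 0, continuous (fun t : R => l + t * (a + t * (b + t * c)))}.
  by rewrite /prop_for /continuous_at mul0r addr0.
have C (d : R) : {for 0, continuous (fun _ : R => d)} by exact: cst_continuous.
have X : {for 0, continuous (@id R)} by exact: cvg_id.
by do 3 (apply: continuousD => //; apply: continuousM => //).
Unshelve. all: by end_near. Qed.

Section Hamiltonians.
Context {R : realType} {n : nat}.
Implicit Types (A V : cplane R n) (O : set (cplane R n)) (I J : {set 'I_n}).

Lemma continuous_re (i : 'I_n) (j : 'I_2) : continuous (fun A : cplane R n => A.1 i j).
Proof.
move=> A; apply: (@continuous_comp _ _ _ fst (fun M : 'M[R]_(n, 2) => M i j)).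
  exact: cvg_fst.
exact: coord_continuous.
Qed.

Lemma continuous_im (i : 'I_n) (j : 'I_2) : continuous (fun A : cplane R n => A.2 i j).
Proof.
move=> A; apply: (@continuous_comp _ _ _ snd (fun M : 'M[R]_(n, 2) => M i j)).
  exact: cvg_snd.
exact: coord_continuous.
Qed.

Lemma Ck_re k O (i : 'I_n) (j : 'I_2) : Ck k O (fun A => A.1 i j).
Proof.
pose f A : R := A.1 i j.
have lf : linear f by move=> a A B; rewrite /f /= !mxE.
pose m := GRing.isLinear.Build _ _ _ _ _ lf.
pose g : {linear _ -> _} := HB.pack f m.
exact: (@Ck_linear _ _ k O g (@continuous_re i j)).
Qed.

Lemma Ck_im k O (i : 'I_n) (j : 'I_2) : Ck k O (fun A => A.2 i j).
Proof.
pose f A : R := A.2 i j.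
have lf : linear f by move=> a A B; rewrite /f /= !mxE.
pose m := GRing.isLinear.Build _ _ _ _ _ lf.
pose g : {linear _ -> _} := HB.pack f m.
exact: (@Ck_linear _ _ k O g (@continuous_im i j)).
Qed.

Lemma muTE A (i : 'I_n) :
  muT A i = (A.1 i 0 * A.1 i 0 + A.2 i 0 * A.2 i 0 +
             (A.1 i 1 * A.1 i 1 + A.2 i 1 * A.2 i 1)) / 2.
Proof. by rewrite /muT /zc /wc /cmx /sqmod !mxE /= -!expr2. Qed.

Lemma Ck_muT k O (i : 'I_n) : open O -> Ck k O (fun A => muT A i).
Proof.
move=> Oo; under eq_fun do rewrite muTE; apply: CkM => //; last exact: Ck_cst.
by do 2 apply: CkD => //; apply: CkM => //; first [exact: Ck_re|exact: Ck_im].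
Qed.

Lemma Ck_edge k O (i : 'I_n) (l : 'I_3) : open O -> Ck k O (fun A => edge A i 0 l).
Proof.
move=> Oo; under eq_fun do rewrite edgeE mxE !expr2.
have re j : Ck k O (fun A => A.1 i j) by exact: Ck_re.
have im j : Ck k O (fun A => A.2 i j) by exact: Ck_im.
have C c : Ck k O (fun=> c) by exact: Ck_cst.
have N F : Ck k O F -> Ck k O (fun x => - F x).
  by move=> cF; under eq_fun do rewrite -mulN1r; exact: CkM.
case: l => -[|[|[|//]]] hl /=; apply: CkM => //.
- by apply: CkD => //; apply: CkM.
- by apply: (N (fun _ => _)); apply: CkD => //; [exact: CkM|apply: (N (fun _ => _)); exact: CkM].
- apply: CkD => //; [apply: CkD => //; [apply: CkD => //; exact: CkM|]|];
  by apply: (N (fun _ => _)); exact: CkM.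
Qed.

Lemma Ck_dot_chord k O I J : open O -> Ck k O (fun A => dot (chord I A) (chord J A)).
Proof.
have chordE K A (l : 'I_3) : chord K A 0 l = \sum_(i in K) edge A i 0 l.
  by rewrite /chord summxE.
move=> Oo; apply: Ck_sum => // l.
by under eq_fun do rewrite !chordE; apply: CkM => //; apply: Ck_sum => // i;
  exact: Ck_edge.
Qed.

Lemma chord_line I A V t :
  chord I (t *: V + A) = chord I A + t *: (dchord I A V + t *: chord I V).
Proof.
rewrite /chord /dchord scalerDr !scaler_sumr -!big_split /=; apply: eq_bigr => i _.
by rewrite !edgeE; apply: eq_vec3; rewrite /dedge !mxE /=; field.
Qed.

Lemma derive_muT A V (i : 'I_n) : 'D_V (fun A => muT A i) A = dmuT A V i.
Proof.
apply: (@derive_quartic _ _ _ _ _ _ (muT V i) 0 0) => t.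
by rewrite !muTE /dmuT /= !mxE; field.
Qed.

Lemma derive_dot_chord I A V :
  'D_V (fun A => dot (chord I A) (chord I A)) A = 2 * dot (chord I A) (dchord I A V).
Proof.
apply: (@derive_quartic _ _ _ _ _ _
  (dot (dchord I A V) (dchord I A V) + 2 * dot (chord I A) (chord I V))
  (2 * dot (dchord I A V) (chord I V)) (dot (chord I V) (chord I V))) => t.
by rewrite chord_line !dotE !mxE; ring.
Qed.

Lemma open_chord_neq0 I : open [set A : cplane R n | chord I A != 0].
Proof.
rewrite (_ : [set A | _] = (fun A => dot (chord I A) (chord I A)) @^-1` [set x | 0 < x]).
  apply: open_comp; last exact: open_gt.
  by move=> A _; exact: (Ck_continuous (Ck_dot_chord 0 I I openT)).
apply/seteqP; split=> A /=; first exact: dot_gt0.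
by apply: contraTneq => ->; rewrite dot0l ltxx.
Qed.

Lemma smooth_enorm_chord I :
  smooth_on [set A : cplane R n | chord I A != 0] (fun A => enorm (chord I A)).
Proof.
move=> k; have -> : (fun A => enorm (chord I A)) =
    Num.sqrt \o (fun A => dot (chord I A) (chord I A)).
  by apply/funext => A; rewrite enormE.
apply: Ck_sqrt; [exact: open_chord_neq0|by move=> A; exact: dot_gt0|].
by apply: Ck_dot_chord; exact: open_chord_neq0.
Qed.

Lemma derive_enorm_chord I A V : chord I A != 0 ->
  'D_V (fun A => enorm (chord I A)) A =
  dot ((enorm (chord I A))^-1 *: chord I A) (dchord I A V).
Proof.
move=> cI; have -> : (fun A => enorm (chord I A)) =
    Num.sqrt \o (fun A => dot (chord I A) (chord I A)).
  by apply/funext => B; rewrite enormE.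
rewrite derive_sqrt_comp ?dot_gt0//; last exact: (Ck_dot_chord 1 I I openT).1.
by rewrite derive_dot_chord -enormE dotZl invfM mulrACA mulVf ?mul1r ?pnatr_eq0.
Qed.

(** The axis of the bending flow: the edges in [I] turn about their own sum with unit angular speed,
    the others rest. *)
Definition bend_coef I A (i : 'I_n) : 'rV[R]_3 :=
  if i \in I then (enorm (chord I A))^-1 *: chord I A else 0.

Definition bend_field I A : cplane R n := row_rot (fun=> 0) (bend_coef I A) A.

Lemma sympl_bend_field I A V : chord I A != 0 ->
  sympl (bend_field I A) V = 'D_V (fun A => enorm (chord I A)) A.
Proof.
move=> cI; rewrite derive_enorm_chord// sympl_row_rot dot_sumr [RHS]big_mkcond.
by apply: eq_bigr => i _; rewrite mul0r add0r /bend_coef; case: ifP; rewrite ?dot0l.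
Qed.

Lemma tangent_rot h v A : \sum_i cross (edge A i) (v i) = 0 -> tangent A (row_rot h v A).
Proof.
move=> e; apply/tangentP; split.
  by apply: big1 => i _; rewrite dmuT_rot.
by rewrite -[RHS]e; apply: eq_bigr => i _; rewrite dedge_rot.
Qed.

(** Turning the edges of [I] about their sum does not move that sum, so the polygon stays closed. *)
Lemma tangent_bend_field I A : tangent A (bend_field I A).
Proof.
apply: tangent_rot.
rewrite (eq_bigr (fun i =>
    if i \in I then cross (edge A i) ((enorm (chord I A))^-1 *: chord I A) else 0)).
  by rewrite -big_mkcond -cross_suml crossZr crossuu scaler0.
by move=> i _; rewrite /bend_coef; case: ifP; rewrite ?cross0r.
Qed.

Definition phase_field (i : 'I_n) A : cplane R n :=
  row_rot (fun j => (j == i)%:R) (fun=> 0) A.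

Lemma sympl_phase_field i A V :
  sympl (phase_field i A) V = 'D_V (fun A => muT A i) A.
Proof.
rewrite derive_muT sympl_row_rot (bigD1 i)//= eqxx mul1r dot0l addr0 big1 ?addr0// => j ji.
by rewrite (negPf ji) mul0r dot0l addr0.
Qed.

Lemma tangent_phase_field i A : tangent A (phase_field i A).
Proof. by apply: tangent_rot; apply: big1 => j _; rewrite cross0r. Qed.

Lemma sympl_phase_l i h v A : sympl (phase_field i A) (row_rot h v A) = 0.
Proof. by rewrite sympl_rotrot; apply: big1 => j _; rewrite dot0l. Qed.

Lemma sympl_phase_r i h v A : sympl (row_rot h v A) (phase_field i A) = 0.
Proof. by rewrite sympl_rotrot; apply: big1 => j _; rewrite cross0r dot0r. Qed.

(** The pairing is the triple product of the two axes with [chord (I :&: J)]. For nested sets this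
    chord is parallel to one of the axes; for disjoint sets it is zero. *)
Lemma sympl_bend_bend I J A :
  [\/ I \subset J, J \subset I | [disjoint I & J]%B] ->
  sympl (bend_field I A) (bend_field J A) = 0.
Proof.
rewrite sympl_rotrot => IJ.
pose u K := (enorm (chord K A))^-1 *: chord K A.
have -> : \sum_i dot (bend_coef I A i) (cross (edge A i) (bend_coef J A i)) =
    dot (u I) (cross (chord (I :&: J) A) (u J)).
  rewrite cross_suml dot_sumr [RHS]big_mkcond; apply: eq_bigr => i _.
  rewrite /bend_coef inE; case: (i \in I); last by rewrite dot0l.
  by case: (i \in J); rewrite ?cross0r ?dot0r.
case: IJ => [/finset.setIidPl ->|/finset.setIidPr ->|/disjoint_setI0 ->].
- by rewrite /u dotZl dot_crossl mulr0.
- by rewrite /u crossZr crossuu scaler0 dot0r.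
- by rewrite /chord big_set0 cross0l dot0r.
Qed.

End Hamiltonians.

(** * Vanishing of coefficients along a laminar family *)

Section LaminarFamily.
Context {R : realType} {T : finType} {m : nat}.
Variables (C : 'I_m -> {set T}) (root : {set T}) (x : T -> 'rV[R]_3).
Variables (c : 'I_m -> R) (k : 'rV[R]_3).

Local Notation tot D := (\sum_(i in (D : {set T})) x i).

Hypothesis C_inj : injective C.
Hypothesis C_laminar : forall a b,
  [\/ C a \subset C b, C b \subset C a | [disjoint C a & C b]%B].
Hypothesis C_gt1 : forall a, (1 < #|C a|)%N.
Hypothesis C_root : forall a, C a \proper root.
Hypothesis root_gt1 : (1 < #|root|)%N.
Hypothesis generic : forall I J : {set T}, (0 < #|I|)%N -> (0 < #|J|)%N ->
  [disjoint I & J]%B -> I :|: J \subset root -> cross (tot I) (tot J) != 0.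
(** This is the condition for edge [i] to be at rest: its total axis, corrected by the common
    rotation [k], is parallel to it. *)
Hypothesis parallel : forall i,
  cross (\sum_(a | i \in C a) c a *: tot (C a) - k) (x i) = 0.

(** The nodes of the tree; singletons are added as leaves, because it is there that [parallel] gives
    information. *)
Let member (D : {set T}) := [|| D == root, [exists a, D == C a] | #|D| == 1%N].

(** The axis accumulated from the root down to [D]: it is [- k] at the root and the vector of
    [parallel] at a leaf. *)
Let coef (D : {set T}) := \sum_(a | D \subset C a) c a *: tot (C a) - k.

Let member_laminar (D E : {set T}) : D \subset root -> E \subset root ->
  member D -> member E -> [\/ D \subset E, E \subset D | [disjoint D & E]%B].
Proof.
have card1 (F G : {set T}) : #|F| == 1%N -> F \subset G \/ [disjoint F & G]%B.
  move=> /cards1P[i ->]; rewrite finset.sub1set disjoints1.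
  by case: (i \in G); [left|right].
move=> Dr Er /or3P[/eqP ->|/existsP[a /eqP ->]|D1]; first by constructor 2.
  move=> /or3P[/eqP ->|/existsP[b /eqP ->]|E1].
  - by constructor 1; exact: proper_sub.
  - exact: C_laminar.
  - by case: (card1 E (C a) E1); rewrite 1?fintype.disjoint_sym; [constructor 2|constructor 3].
by move=> _; case: (card1 D E D1); [constructor 1|constructor 3].
Qed.

(* [E] is a child of [D] in the forest of members: going from [D] to [E], [coef]
   only changes by a multiple of [tot E]. *)
Let cross_coef_child (D E : {set T}) i : D \subset root -> member D -> member E ->
  E \proper D -> i \in E ->
  (forall F : {set T}, member F -> F \proper D -> i \in F -> (#|F| <= #|E|)%N) ->
  cross (coef E) (tot E) = 0 -> cross (coef D) (tot E) = 0.
Proof.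
move=> Dr mD mE ED iE maxE; have sED := proper_sub ED.
move=> coefE; rewrite -[RHS]coefE /coef !crossDl !cross_suml; congr (_ + _).
rewrite [RHS](bigID (fun a => D \subset C a)) /= [X in _ = _ + X]big1 ?addr0.
  apply: eq_bigl => b.
  by case: (boolP (D \subset C b)) => [/(fintype.subset_trans sED) ->|]; rewrite ?andbF.
move=> a /andP[sEa nDa]; have mCa : member (C a).
  by apply/or3P; constructor 2; apply/existsP; exists a.
have iCa : i \in C a := fintype.subsetP sEa i iE.
have iD : i \in D := fintype.subsetP sED i iE.
have CaD : C a \proper D.
  rewrite fintype.properE nDa andbT.
  have [Ds|//|/disjoint_setI0/finset.setP/(_ i)] :=
    member_laminar Dr (proper_sub (C_root a)) mD mCa; first by rewrite Ds in nDa.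
  by rewrite !inE iD iCa.
have -> : C a = E by apply/esym/eqP; rewrite eqEcard sEa maxE.
by rewrite crossZl crossuu scaler0.
Qed.

Let child_exists (D : {set T}) i : i \in D -> (1 < #|D|)%N ->
  exists E : {set T}, [/\ member E, E \proper D, i \in E &
    forall F : {set T}, member F -> F \proper D -> i \in F -> (#|F| <= #|E|)%N].
Proof.
move=> iD D1; pose P (F : {set T}) := [&& member F, F \proper D & i \in F].
have P1 : P [set i]%SET.
  rewrite /P /member cards1 eqxx !orbT finset.set11 andbT /= properEcard finset.sub1set iD.
  by rewrite cards1.
have [E /and3P[mE ED iE] maxE] := arg_maxnP (fun F : {set T} => #|F|) P1.
by exists E; split=> // F mF FD iF; apply: maxE; apply/and3P.
Qed.

(** Induction from the leaves. A node with two elements or more has two distinct maximal proper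
    members [E] and [F], disjoint by laminarity. By induction [coef D] is parallel to both their
    totals, which are not parallel to each other, so it vanishes. *)
Let coef_member (D : {set T}) : D \subset root -> member D ->
  cross (coef D) (tot D) = 0 /\ ((1 < #|D|)%N -> coef D = 0).
Proof.
have [p] := ubnP #|D|; elim: p D => [//|p IH] D; rewrite ltnS => Dp Dr mD.
have [D1|D1] := boolP (#|D| == 1%N).
  rewrite (eqP D1); split=> //; have /cards1P[i eD] := D1.
  rewrite /coef eD big_set1 -[RHS](parallel i); congr (cross (_ - _) _).
  by apply: eq_bigl => a; rewrite finset.sub1set.
have Dgt1 : (1 < #|D|)%N.
  case/or3P: mD => [/eqP ->//|/existsP[a /eqP ->]//|]; by rewrite (negPf D1).
suff -> : coef D = 0 by rewrite cross0l.
have [i iD] : exists i, i \in D by apply/finset.set0Pn; rewrite -card_gt0 ltnW.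
have [E [mE ED iE maxE]] := child_exists iD Dgt1.
have [_ [j jD jE]] := fintype.properP ED.
have [F [mF FD jF maxF]] := child_exists jD Dgt1.
have Er := fintype.subset_trans (proper_sub ED) Dr.
have Fr := fintype.subset_trans (proper_sub FD) Dr.
have crossE : cross (coef D) (tot E) = 0.
  apply: (cross_coef_child _ _ _ ED iE) => //; apply: (IH E _ Er mE).1.
  exact: leq_trans (proper_card ED) Dp.
have crossF : cross (coef D) (tot F) = 0.
  apply: (cross_coef_child _ _ _ FD jF) => //; apply: (IH F _ Fr mF).1.
  exact: leq_trans (proper_card FD) Dp.
apply: cross_eq0_common crossE crossF _; apply: generic.
- by apply/card_gt0P; exists i.
- by apply/card_gt0P; exists j.
- have [EF|FE|//] := member_laminar Er Fr mE mF.
    have iF := fintype.subsetP EF i iE.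
    have /eqP eEF : E == F by rewrite eqEcard EF maxE.
    by rewrite eEF jF in jE.
  by rewrite (fintype.subsetP FE j jF) in jE.
- by rewrite finset.subUset Er Fr.
Qed.

(** At the root, [coef] is [- k]. If some coefficient is nonzero, let [b] be one with [C b] largest:
    then [coef (C b)] reduces to [c b *: tot (C b)], whose vector is nonzero because it is not
    parallel to the total of [root :\: C b]. *)
Lemma laminar_coef_eq0 : (forall a, c a = 0) /\ k = 0.
Proof.
have k0 : k = 0.
  have [] := coef_member (subxx root); first by rewrite /member eqxx.
  move=> _ /(_ root_gt1); rewrite /coef big_pred0 ?sub0r => [/eqP|a].
    by rewrite oppr_eq0 => /eqP.
  by have := C_root a; rewrite fintype.properE => /andP[_ /negPf].
split=> // a; apply/eqP/negPn/negP => ca.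
have [b cb maxb] := arg_maxnP (fun b => #|C b|) (ca : (fun a => c a != 0) a).
have [] := coef_member (proper_sub (C_root b)).
  by apply/or3P; constructor 2; apply/existsP; exists b.
move=> _ /(_ (C_gt1 b)); rewrite /coef k0 subr0 (bigD1 b)//= [X in _ + X]big1 ?addr0.
  move=> /eqP; rewrite scaler_eq0 (negPf cb) => /eqP tb.
  have [_ [j jr jb]] := fintype.properP (C_root b).
  have := generic (I := C b) (J := root :\: C b).
  rewrite tb cross0l eqxx => /(_ (ltnW (C_gt1 b))).
  have -> : (0 < #|root :\: C b|)%N by apply/card_gt0P; exists j; rewrite inE jb.
  rewrite finset.disjoints_subset finset.setCD finset.subsetUr => /(_ isT isT).
  by rewrite finset.subUset (proper_sub (C_root b)) finset.subsetDl => /(_ isT).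
move=> d /andP[bd db]; have [->|cd] := eqVneq (c d) 0; first by rewrite scale0r.
have /eqP/C_inj ebd : C b == C d by rewrite eqEcard bd; exact: maxb.
by rewrite ebd eqxx in db.
Qed.

End LaminarFamily.

(** * The equations of [stiefel] and their Lagrange multipliers *)

Section Stiefel.
Context {R : realType} {n : nat}.
Implicit Types (A V : cplane R n) (r : 'I_n -> R).

Lemma stiefelP r A : stiefel r A <->
  [/\ \sum_i (A.1 i 0 ^+ 2 + A.2 i 0 ^+ 2) = 2 * \sum_i r i,
      \sum_i (A.1 i 1 ^+ 2 + A.2 i 1 ^+ 2) = 2 * \sum_i r i,
      \sum_i (A.1 i 0 * A.1 i 1 + A.2 i 0 * A.2 i 1) = 0 &
      \sum_i (A.2 i 0 * A.1 i 1 - A.1 i 0 * A.2 i 1) = 0].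
Proof.
rewrite /stiefel /=.
have -> : \sum_i sqmod (zc A i) = \sum_i (A.1 i 0 ^+ 2 + A.2 i 0 ^+ 2).
  by apply: eq_bigr => i _; rewrite /zc /cmx /sqmod !mxE.
have -> : \sum_i sqmod (wc A i) = \sum_i (A.1 i 1 ^+ 2 + A.2 i 1 ^+ 2).
  by apply: eq_bigr => i _; rewrite /wc /cmx /sqmod !mxE.
have -> : \sum_i zc A i * (wc A i)^*%C =
    ((\sum_i (A.1 i 0 * A.1 i 1 + A.2 i 0 * A.2 i 1)) +i*
     (\sum_i (A.2 i 0 * A.1 i 1 - A.1 i 0 * A.2 i 1)))%C.
  apply/eqP; rewrite eq_complex /=; apply/andP; split; apply/eqP.
    rewrite (raddf_sum (@complex.Re R : Rcomplex R -> R)).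
    by apply: eq_bigr => i _; rewrite /zc /wc /cmx !mxE /=; ring.
  rewrite (raddf_sum (@complex.Im R : Rcomplex R -> R)).
  by apply: eq_bigr => i _; rewrite /zc /wc /cmx !mxE /=; ring.
split=> [[-> -> [-> ->]]//|[-> -> -> ->]]; by split.
Qed.

Lemma chordTE A : chord [set: 'I_n]%SET A = \sum_i edge A i.
Proof. by apply: eq_bigl => i; rewrite inE. Qed.

Lemma chord_setT r A : stiefel r A -> chord [set: 'I_n]%SET A = 0.
Proof.
move=> /stiefelP[e0 e1 e2 e3].
have -> : chord [set: 'I_n]%SET A = vec3
   ((\sum_i (A.1 i 0 * A.1 i 1 + A.2 i 0 * A.2 i 1)) / 2)
   ((\sum_i (A.2 i 0 * A.1 i 1 - A.1 i 0 * A.2 i 1)) / 2)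
   ((\sum_i (A.1 i 0 ^+ 2 + A.2 i 0 ^+ 2) - \sum_i (A.1 i 1 ^+ 2 + A.2 i 1 ^+ 2)) / 4).
  rewrite -sumrB !mulr_suml chordTE; apply: eq_vec3; rewrite summxE !vec3E;
  by apply: eq_bigr => i _; rewrite edgeE vec3E; congr (_ / _); ring.
by rewrite e0 e1 e2 e3 subrr !mul0r; apply: eq_vec3; rewrite vec3E mxE.
Qed.

(** The polygon closes up; this is why either side group of a diagonal gives the same length. *)
Lemma chordC r A (J : {set 'I_n}) : stiefel r A -> chord (~: J)%SET A = - chord J A.
Proof.
move=> /chord_setT; rewrite chordTE (bigID (mem J)) /= => /eqP.
by rewrite addrC addr_eq0 => /eqP <-; apply: eq_bigl => i; rewrite inE.
Qed.

Lemma sympl_linear (X V W : cplane R n) a :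
  sympl X (a *: V + W) = a * sympl X V + sympl X W.
Proof.
rewrite /sympl mulr_sumr -big_split; apply: eq_bigr => i _ /=.
by rewrite mulr_sumr -big_split; apply: eq_bigr => j _ /=; rewrite !mxE; ring.
Qed.

Lemma sympl_nondeg (X : cplane R n) : (forall V, sympl X V = 0) -> X = 0.
Proof.
(* The test vector is [X] multiplied by the imaginary unit; the pairing is then the squared norm of
   [X]. *)
move=> /(_ (- X.2, X.1)); rewrite /sympl.
have sq0 i j : 0 <= X.1 i j * X.1 i j - X.2 i j * (- X.2) i j.
  by rewrite mxE mulrN opprK -!expr2 addr_ge0 ?sqr_ge0.
move=> /eqP; rewrite psumr_eq0 => [/allP e|i _]; last exact: sumr_ge0.
have e0 i j : X.1 i j = 0 /\ X.2 i j = 0.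
  have := e i (mem_index_enum i); rewrite /= psumr_eq0// => /allP/(_ j (mem_index_enum j)).
  rewrite /= mxE mulrN opprK -!expr2 paddr_eq0 ?sqr_ge0// !sqrf_eq0.
  by move=> /andP[/eqP -> /eqP ->].
by apply/eqP; apply/andP; split; apply/eqP/matrixP => i j; rewrite mxE;
  have [] := e0 i j.
Qed.

(* [A *m sigma] for the Hermitian matrix [sigma] of coordinates [v] in the
   Pauli basis: these vectors are dual to the differentials of the equations
   of [stiefel]. *)
Definition pauli (v : 'rV[R]_3) A : cplane R n :=
  (\matrix_(i, j) [:: v 0 0 * A.1 i 1 - v 0 1 * A.2 i 1 + v 0 2 * A.1 i 0;
                      v 0 0 * A.1 i 0 + v 0 1 * A.2 i 0 - v 0 2 * A.1 i 1]`_j,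
   \matrix_(i, j) [:: v 0 0 * A.2 i 1 + v 0 1 * A.1 i 1 + v 0 2 * A.2 i 0;
                      v 0 0 * A.2 i 0 - v 0 1 * A.1 i 0 - v 0 2 * A.2 i 1]`_j).

Lemma sum_dmuT_pauli r A v : stiefel r A -> \sum_i dmuT A (pauli v A) i = 0.
Proof.
move=> /chord_setT; rewrite chordTE => e.
rewrite -[RHS](dot0r (4 *: v)) -e dot_sumr; apply: eq_bigr => i _.
by rewrite edgeE dotZl dotE /dmuT !vec3E !mxE /=; field.
Qed.

Lemma sum_dedge_pauli r A v : stiefel r A ->
  \sum_i dedge A (pauli v A) i = (2 * \sum_i r i) *: v.
Proof.
move=> /stiefelP[e0 e1 _ _].
have -> : 2 * \sum_i r i = \sum_i (A.1 i 0 ^+ 2 + A.2 i 0 ^+ 2 +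
    (A.1 i 1 ^+ 2 + A.2 i 1 ^+ 2)) / 2.
  by rewrite -mulr_suml big_split /= e0 e1; field.
rewrite scaler_suml; apply: eq_bigr => i _.
by apply: eq_vec3; rewrite /dedge !mxE /=; field.
Qed.

(** Scaling completes the dual family: along [A] itself the quadratic total moment grows at twice
    its value, while the sum of the edges, being zero, does not move. *)
Lemma sum_dmuT_id r A : stiefel r A -> \sum_i dmuT A A i = 4 * \sum_i r i.
Proof.
move=> /stiefelP[e0 e1 _ _].
have -> : 4 * \sum_i r i = 2 * \sum_i r i + 2 * \sum_i r i by ring.
rewrite -{1}e0 -e1 -big_split /=; apply: eq_bigr => i _; rewrite /dmuT; ring.
Qed.

Lemma sum_dedge_id r A : stiefel r A -> \sum_i dedge A A i = 0.
Proof.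
move=> /chord_setT; rewrite chordTE => e.
transitivity (2 *: \sum_i edge A i); last by rewrite e scaler0.
rewrite scaler_sumr; apply: eq_bigr => i _.
by rewrite edgeE; apply: eq_vec3; rewrite /dedge !mxE /=; field.
Qed.

(** The trailing [0] gives every layer the shape [a *: V + W], so that one linearity rule can be
    iterated. *)
Lemma pauliE v A : pauli v A =
  v 0 0 *: pauli (vec3 1 0 0) A + (v 0 1 *: pauli (vec3 0 1 0) A +
  (v 0 2 *: pauli (vec3 0 0 1) A + 0)).
Proof.
by apply/eqP; apply/andP; split; apply/eqP/matrixP => i [[|[|//]] hj];
  rewrite !mxE /=; ring.
Qed.

Lemma row_rotB h v k0 (k : 'rV[R]_3) A V :
  sympl (row_rot (fun i => h i - k0) (fun i => v i - k) A) V =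
  sympl (row_rot h v A) V - (k0 * \sum_i dmuT A V i + dot k (\sum_i dedge A V i)).
Proof.
rewrite !sympl_row_rot mulr_sumr dot_sumr -big_split -sumrB; apply: eq_bigr => i _ /=.
by rewrite !dotE !mxE; ring.
Qed.

(* Lagrange multipliers: a covector that vanishes on [tangent A] is a
   combination of the differentials of the equations of [stiefel]. *)
Lemma sympl_row_rot_tangent r A h v : stiefel r A -> \sum_i r i != 0 ->
  (forall V, tangent A V -> sympl (row_rot h v A) V = 0) ->
  exists k0 k, row_rot (fun i => h i - k0) (fun i => v i - k) A = 0.
Proof.
move=> stA S0 l0; set S := \sum_i r i in S0.
pose l V := sympl (row_rot h v A) V.
have lE a V W : l (a *: V + W) = a * l V + l W by exact: sympl_linear.
have l00 : l 0 = 0.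
  by have := lE (-1) 0 0; rewrite scaler0 addr0 mulN1r addNr.
have lpauli u : l (pauli u A) = dot u (vec3 (l (pauli (vec3 1 0 0) A))
    (l (pauli (vec3 0 1 0) A)) (l (pauli (vec3 0 0 1) A))).
  by rewrite pauliE !lE l00 dotE !vec3E addr0 addrA.
move: lpauli; set L := vec3 _ _ _ => lpauli.
(* The multipliers are the values of [l] on the dual vectors, divided by the rates [4 * S] of
   scaling and [2 * S] of [pauli]. *)
exists (l A / (4 * S)), ((2 * S)^-1 *: L); apply: sympl_nondeg => V.
rewrite row_rotB -/(l V); apply/eqP; rewrite subr_eq0; apply/eqP.
set a := \sum_i dmuT A V i; set b := \sum_i dedge A V i.
(* [W] is [V] corrected by dual vectors so that both linearised equations hold. *)
pose W := - (a / (4 * S)) *: A + (1 *: pauli (- (2 * S)^-1 *: b) A + V).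
have dmuTD c X Y i : dmuT A (c *: X + Y) i = c * dmuT A X i + dmuT A Y i.
  by rewrite /dmuT /= !mxE; ring.
have dedgeD c X Y i : dedge A (c *: X + Y) i = c *: dedge A X i + dedge A Y i.
  by rewrite /dedge; apply: eq_vec3; rewrite !mxE /= ?mxE; field.
have tW : tangent A W.
  apply/tangentP; split.
    under eq_bigr do rewrite !dmuTD.
    rewrite 2!big_split /= -!mulr_sumr (sum_dmuT_pauli _ stA) (sum_dmuT_id stA) -/a -/S.
    by field.
  under eq_bigr do rewrite !dedgeD.
  rewrite 2!big_split /= -!scaler_sumr (sum_dedge_pauli _ stA) (sum_dedge_id stA) -/b -/S.
  rewrite scaler0 add0r scale1r scalerA mulrN divff ?mulf_neq0 ?pnatr_eq0//.
  by rewrite scaleN1r addNr.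
have := l0 _ tW; rewrite -/(l W) !lE lpauli mul1r dotZl (dotC b) dotZl => /eqP.
rewrite addrA addrC addr_eq0 => /eqP ->; field.
by rewrite S0.
Qed.

Lemma row_rot_eq0 h v A i : row_rot h v A = 0 -> cross (edge A i) (v i) = 0.
Proof.
by move=> e; rewrite -(dedge_rot h v) e; apply: eq_vec3; rewrite /dedge !mxE /=; ring.
Qed.

(** Without an axis the row only changes phase, at rate [h i]; if that rate is nonzero and the row
    is at rest, the row is zero and so is its edge. *)
Lemma row_rot_eq0_coef h v A i : row_rot h v A = 0 -> v i = 0 -> edge A i != 0 -> h i = 0.
Proof.
move=> e vi; apply: contraNeq => hi.
have e1 j : (row_rot h v A).1 i j = 0 by rewrite e mxE.
have e2 j : (row_rot h v A).2 i j = 0 by rewrite e mxE.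
have := (e1 0, e1 1, (e2 0, e2 1)); rewrite !mxE vi !mxE /= !mul0r !(subr0, addr0, mulNr).
case=> -[/eqP + /eqP + [/eqP + /eqP]]; rewrite ?oppr_eq0 !mulf_eq0 (negPf hi) /=.
move=> /eqP a /eqP b /eqP c /eqP d; rewrite edgeE a b c d; apply/eqP.
by apply: eq_vec3; rewrite !mxE /=; ring.
Qed.

End Stiefel.

(** * Gram forms and Gram-Schmidt orthogonalisation *)

Lemma near0_horner_neq0 (R : realType) (p : {poly R}) : p != 0 ->
  \forall t \near 0^', p.[t] != 0.
Proof.
move=> p0; have [k [q q0 ->]] := multiplicity_XsubC p 0.
rewrite p0 /= rootE in q0.
have q_near : \forall t \near 0, q.[t] != 0.
  have oq : open (horner q @^-1` [set x | x != 0]).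
    by apply: open_comp; [move=> x _; exact: continuous_horner|exact: open_neq].
  exact: open_nbhs_nbhs.
near=> t; rewrite hornerM horner_exp hornerXsubC subr0 mulf_neq0//.
  by near: t; exact: nbhs_dnbhs.
by rewrite expf_neq0//; near: t; exact: nbhs_dnbhs_neq.
Unshelve. all: by end_near. Qed.

Lemma cvg_mx (R : realType) (T : Type) (F : set_system T) (m p : nat)
    (f : T -> 'M[R]_(m, p)) (M : 'M[R]_(m, p)) : Filter F ->
  (forall i j, f x i j @[x --> F] --> M i j) -> f x @[x --> F] --> M.
Proof.
move=> FF cf B [P MP sPB]; apply: (@filterS _ F FF _ _ (fun x => sPB (f x))).
by apply: filter_forall => i; apply: filter_forall => j; exact: cf (MP i j).
Qed.

Lemma mulf_neq0_eq0 (K : idomainType) (x y : K) : x != 0 -> x * y = 0 -> y = 0.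
Proof. by move=> /negPf x0 /eqP; rewrite mulf_eq0 x0 => /eqP. Qed.

Section GramSchmidt.
Context {n : nat}.

Section Forms.
Context {K : comNzRingType}.
Implicit Types (I J : {set 'I_n}) (L : 'M[K]_(n, 2) * 'M[K]_(n, 2)).

(** These four forms are the real coordinates of the Hermitian Gram matrix of the two columns
    restricted to the rows in [I]. The ring is arbitrary so that they also apply to matrices of
    polynomials. *)
Definition zz I L := \sum_(i in I) (L.1 i 0 ^+ 2 + L.2 i 0 ^+ 2).
Definition ww I L := \sum_(i in I) (L.1 i 1 ^+ 2 + L.2 i 1 ^+ 2).
Definition zw_re I L := \sum_(i in I) (L.1 i 0 * L.1 i 1 + L.2 i 0 * L.2 i 1).
Definition zw_im I L := \sum_(i in I) (L.1 i 0 * L.2 i 1 - L.2 i 0 * L.1 i 1).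

Definition det3 (a b c a' b' c' a'' b'' c'' : K) :=
  a * (b' * c'' - c' * b'') - b * (a' * c'' - c' * a'') + c * (a' * b'' - b' * a'').

(** With [gram_minor_im], two of the maximal minors of the 3 by 4 array of Gram forms of [I], [J]
    and all rows. The span of this pair is stable under [triu], which mixes the second minor into
    the first. *)
Definition gram_minor I J L :=
  det3 (zz I L) (zw_re I L) (ww I L) (zz J L) (zw_re J L) (ww J L)
       (zz [set: 'I_n]%SET L) (zw_re [set: 'I_n]%SET L) (ww [set: 'I_n]%SET L).

Definition gram_minor_im I J L :=
  det3 (zz I L) (zw_re I L) (zw_im I L) (zz J L) (zw_re J L) (zw_im J L)
       (zz [set: 'I_n]%SET L) (zw_re [set: 'I_n]%SET L) (zw_im [set: 'I_n]%SET L).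

End Forms.

Lemma gram_minor_morph (K K' : comNzRingType) (f : {rmorphism K -> K'}) I J
    (L : 'M[K]_(n, 2) * 'M[K]_(n, 2)) :
  f (gram_minor I J L) = gram_minor I J (map_mx f L.1, map_mx f L.2).
Proof.
have zzf I' : f (zz I' L) = zz I' (map_mx f L.1, map_mx f L.2).
  by rewrite rmorph_sum; apply: eq_bigr => i _; rewrite rmorphD !rmorphXn !mxE.
have wwf I' : f (ww I' L) = ww I' (map_mx f L.1, map_mx f L.2).
  by rewrite rmorph_sum; apply: eq_bigr => i _; rewrite rmorphD !rmorphXn !mxE.
have zwf I' : f (zw_re I' L) = zw_re I' (map_mx f L.1, map_mx f L.2).
  by rewrite rmorph_sum; apply: eq_bigr => i _; rewrite rmorphD !rmorphM !mxE.
by rewrite /gram_minor /det3 !(rmorphB, rmorphD, rmorphM) !zzf !wwf !zwf.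
Qed.

Context {R : realType}.
Implicit Types (I J : {set 'I_n}) (A B L : cplane R n) (r : 'I_n -> R).

(* [L] times the upper triangular matrix [[a, c + i d], [0, b]]. *)
Definition triu (a b c d : R) L : cplane R n :=
  (\matrix_(i, j) [:: a * L.1 i 0; b * L.1 i 1 + c * L.1 i 0 - d * L.2 i 0]`_j,
   \matrix_(i, j) [:: a * L.2 i 0; b * L.2 i 1 + c * L.2 i 0 + d * L.1 i 0]`_j).

Lemma zz_triu a b c d I L : zz I (triu a b c d L) = a ^+ 2 * zz I L.
Proof. by rewrite /zz mulr_sumr; apply: eq_bigr => i _; rewrite !mxE /=; ring. Qed.

Lemma zw_re_triu a b c d I L :
  zw_re I (triu a b c d L) = a * b * zw_re I L + a * c * zz I L.
Proof.
rewrite /zz /zw_re !mulr_sumr -big_split; apply: eq_bigr => i _ /=.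
by rewrite !mxE /=; ring.
Qed.

Lemma zw_im_triu a b c d I L :
  zw_im I (triu a b c d L) = a * b * zw_im I L + a * d * zz I L.
Proof.
rewrite /zz /zw_im !mulr_sumr -big_split; apply: eq_bigr => i _ /=.
by rewrite !mxE /=; ring.
Qed.

Lemma ww_triu a b c d I L : ww I (triu a b c d L) =
  b ^+ 2 * ww I L + (c ^+ 2 + d ^+ 2) * zz I L +
  2 * b * c * zw_re I L + 2 * b * d * zw_im I L.
Proof.
rewrite /zz /zw_re /zw_im /ww !mulr_sumr -!big_split; apply: eq_bigr => i _ /=.
by rewrite !mxE /=; ring.
Qed.

Lemma gram_minor_triu a b c d I J L : gram_minor I J (triu a b c d L) =
  a ^+ 3 * b * (b ^+ 2 * gram_minor I J L + 2 * b * d * gram_minor_im I J L).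
Proof.
rewrite /gram_minor /gram_minor_im !(zz_triu, zw_re_triu, ww_triu) /det3.
ring.
Qed.

Lemma gram_minor_im_triu a b c d I J L :
  gram_minor_im I J (triu a b c d L) = a ^+ 4 * b ^+ 2 * gram_minor_im I J L.
Proof. rewrite /gram_minor_im !(zz_triu, zw_re_triu, zw_im_triu) /det3; ring. Qed.

Lemma stiefel_formsP r A : stiefel r A <->
  [/\ zz [set: 'I_n]%SET A = 2 * \sum_i r i, ww [set: 'I_n]%SET A = 2 * \sum_i r i,
      zw_re [set: 'I_n]%SET A = 0 & zw_im [set: 'I_n]%SET A = 0].
Proof.
have e (F : 'I_n -> R) : \sum_(i in [set: 'I_n]%SET) F i = \sum_i F i.
  by apply: eq_bigl => i; rewrite inE.
rewrite stiefelP /zz /ww /zw_re /zw_im !e.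
suff -> : \sum_i (A.1 i 0 * A.2 i 1 - A.2 i 0 * A.1 i 1) =
    - \sum_i (A.2 i 0 * A.1 i 1 - A.1 i 0 * A.2 i 1).
  split=> -[-> -> -> /eqP]; rewrite ?oppr_eq0 => /eqP ->; rewrite ?oppr0 //.
by rewrite -sumrN; apply: eq_bigr => i _; rewrite opprB.
Qed.

Lemma chord_forms I L :
  chord I L = vec3 (zw_re I L / 2) (- zw_im I L / 2) ((zz I L - ww I L) / 4).
Proof.
rewrite /zz /ww /zw_re /zw_im -sumrB -sumrN !mulr_suml; apply: eq_vec3;
  rewrite summxE !vec3E; apply: eq_bigr => i _; rewrite edgeE vec3E //.
by congr (_ / _); ring.
Qed.

(* Chords of [B] are parallel iff the Gram matrices of the rows in [I], in [J]
   and of all rows are linearly dependent, a property that does not change under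
   the right action of GL(2). *)
Lemma cross_chord_triu r I J L a b c d : a != 0 -> b != 0 ->
  stiefel r (triu a b c d L) -> gram_minor I J L != 0 ->
  cross (chord I (triu a b c d L)) (chord J (triu a b c d L)) != 0.
Proof.
move=> a0 b0; set B := triu a b c d L => /stiefel_formsP[e1 e2 e3 e4].
apply: contra_neq => cr.
(* On [stiefel] the array row of all sides is [s, 0, 0, s] with [s = 2 * \sum_i r i], so the two
   minors of [B] are multiples of these coordinates of the cross product; the constants 8 and -4
   below undo the denominators of the edges and a sign. *)
have cr1 := congr1 (fun u : 'rV[R]_3 => u 0 1) cr.
have cr2 := congr1 (fun u : 'rV[R]_3 => u 0 2) cr.
rewrite !chord_forms /cross !vec3E !mxE in cr1 cr2.
have mB : gram_minor I J B = 0.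
  rewrite /gram_minor /det3 e1 e2 e3.
  set x := (X in X = 0 :> R); pose k := 8 * (2 * \sum_i r i).
  have -> : x = k * ((zz I B - ww I B) / 4 * (zw_re J B / 2) -
      zw_re I B / 2 * ((zz J B - ww J B) / 4)) by rewrite /x /k; field.
  by rewrite cr1 mulr0.
have mB' : gram_minor_im I J B = 0.
  rewrite /gram_minor_im /det3 e1 e3 e4.
  set x := (X in X = 0 :> R); pose k := - 4 * (2 * \sum_i r i).
  have -> : x = k * (zw_re I B / 2 * (- zw_im J B / 2) -
      - zw_im I B / 2 * (zw_re J B / 2)) by rewrite /x /k; field.
  by rewrite cr2 mulr0.
have m0 : gram_minor_im I J L = 0.
  by move: mB'; rewrite gram_minor_im_triu; apply: mulf_neq0_eq0; rewrite mulf_neq0 ?expf_neq0.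
move: mB; rewrite gram_minor_triu m0 mulr0 addr0.
move=> /(mulf_neq0_eq0 (mulf_neq0 (expf_neq0 _ a0) b0)).
exact: mulf_neq0_eq0 (expf_neq0 _ b0).
Qed.

(** The squared norms of the first column and, for [ortho_ww], of the component of the second column
    orthogonal to the first. *)
Definition ortho_zz L : R := zz [set: 'I_n]%SET L.
Definition ortho_ww L : R := ww [set: 'I_n]%SET L -
  (zw_re [set: 'I_n]%SET L ^+ 2 + zw_im [set: 'I_n]%SET L ^+ 2) / ortho_zz L.

Definition gram_schmidt (S : R) L : cplane R n :=
  let a := Num.sqrt S / Num.sqrt (ortho_zz L) in
  let b := Num.sqrt S / Num.sqrt (ortho_ww L) in
  triu a b (- b * (zw_re [set: 'I_n]%SET L / ortho_zz L))
           (- b * (zw_im [set: 'I_n]%SET L / ortho_zz L)) L.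

Lemma gram_schmidt_stiefel r L : 0 < \sum_i r i -> 0 < ortho_zz L -> 0 < ortho_ww L ->
  stiefel r (gram_schmidt (2 * \sum_i r i) L).
Proof.
move=> S0 z0 w0; apply/stiefel_formsP; rewrite /gram_schmidt.
rewrite zz_triu zw_re_triu zw_im_triu ww_triu.
have sq c d : 0 < c -> 0 < d -> (Num.sqrt c / Num.sqrt d) ^+ 2 = c / d :> R.
  by move=> c0 d0; rewrite expr_div_n !sqr_sqrtr ?ltW.
have zn : zz [set: 'I_n]%SET L != 0 by rewrite gt_eqF.
have S2 : 0 < 2 * \sum_i r i by rewrite mulr_gt0.
split.
- by rewrite sq// divfK.
- rewrite -[RHS](divfK (lt0r_neq0 w0)) -(sq _ _ S2 w0).
  rewrite [X in _ = _ * X]/ortho_ww /ortho_zz; field.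
  by rewrite zn gt_eqF// sqrtr_gt0.
- rewrite /ortho_zz; field.
  by rewrite zn !gt_eqF// sqrtr_gt0.
- rewrite /ortho_zz; field.
  by rewrite zn !gt_eqF// sqrtr_gt0.
Qed.

End GramSchmidt.

(** * Openness and density of generic matrices *)

Section Perturbation.
Context {R : realType} {n : nat}.
Implicit Types (I J : {set 'I_n}) (A B L : cplane R n) (r : 'I_n -> R).

Lemma gram_schmidt_id r A : 0 < \sum_i r i -> stiefel r A ->
  gram_schmidt (2 * \sum_i r i) A = A.
Proof.
move=> S0 /stiefel_formsP[e1 e2 e3 e4].
have S2 : Num.sqrt (2 * \sum_i r i) != 0 by rewrite gt_eqF// sqrtr_gt0 mulr_gt0.
rewrite /gram_schmidt /ortho_ww /ortho_zz e1 e2 e3 e4 expr0n /= addr0 !mul0r subr0.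
rewrite !mulr0 divff// /triu; case: A {e1 e2 e3 e4} => X Y /=.
by congr pair; apply/matrixP => i [[|[|//]] hj]; rewrite !mxE /= !(mul1r, mul0r, addr0, subr0);
  congr (_ i _); exact: val_inj.
Qed.

Lemma continuous_forms I : [/\ continuous (@zz n R I), continuous (@ww n R I),
  continuous (@zw_re n R I) & continuous (@zw_im n R I)].
Proof.
have re i j : Ck 0 setT (fun A : cplane R n => A.1 i j) by exact: Ck_re.
have im i j : Ck 0 setT (fun A : cplane R n => A.2 i j) by exact: Ck_im.
have M F G : Ck 0 setT F -> Ck 0 setT G -> Ck 0 setT (fun A : cplane R n => F A * G A).
  by move=> cF cG; apply: CkM => //; exact: openT.
have D F G : Ck 0 setT F -> Ck 0 setT G -> Ck 0 setT (fun A : cplane R n => F A + G A).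
  by move=> cF cG; apply: CkD => //; exact: openT.
have N F : Ck 0 setT F -> Ck 0 setT (fun A : cplane R n => - F A).
  by move=> cF; under eq_fun do rewrite -mulN1r; apply: M => //; exact: Ck_cst.
have S (F : 'I_n -> cplane R n -> R) : (forall i, Ck 0 setT (F i)) ->
    continuous (fun A => \sum_(i in I) F i A).
  by move=> cF A; apply: (Ck_sum _ _ openT cF).
split; apply: S => i; [under eq_fun do rewrite !expr2|under eq_fun do rewrite !expr2| |];
  by apply: D => //; [exact: M|first [exact: M|apply: N; exact: M]].
Qed.

Lemma ortho_gt0_near r A : 0 < \sum_i r i -> stiefel r A ->
  [/\ {for A, continuous (@ortho_zz n R)}, {for A, continuous (@ortho_ww n R)},
      ortho_zz A = 2 * \sum_i r i & ortho_ww A = 2 * \sum_i r i].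
Proof.
move=> S0 /stiefel_formsP[e1 e2 e3 e4].
have [czz cww cre cim] := continuous_forms [set: 'I_n]%SET.
have ez : ortho_zz A = 2 * \sum_i r i by [].
split=> //; first exact: czz.
  apply: continuousB; first exact: cww.
  apply: continuousM; last first.
    by apply: continuousV; [rewrite ez gt_eqF// mulr_gt0|exact: czz].
  by apply: continuousD;
    [exact: (continuousM (cre A) (cre A))|exact: (continuousM (cim A) (cim A))].
by rewrite /ortho_ww e2 e3 e4 expr0n /= addr0 mul0r subr0.
Qed.

Lemma cvg_cplane (T : Type) (F : set_system T) (f : T -> cplane R n) A : Filter F ->
  (forall i j, (f x).1 i j @[x --> F] --> A.1 i j) ->
  (forall i j, (f x).2 i j @[x --> F] --> A.2 i j) -> f x @[x --> F] --> A.
Proof.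
move=> FF f1 f2.
case: A f1 f2 => X Y f1 f2 B [[P Q] [XP YQ] sB].
have c1 : (f x).1 @[x --> F] --> X by exact: cvg_mx.
have c2 : (f x).2 @[x --> F] --> Y by exact: cvg_mx.
have F1 : F [set x | P (f x).1] := c1 P XP.
have F2 : F [set x | Q (f x).2] := c2 Q YQ.
have FB : F [set x | B (f x)] by apply: filterS2 F1 F2 => x Px Qx; apply: sB.
exact: FB.
Qed.

Lemma gram_schmidt_cvg r A : 0 < \sum_i r i -> stiefel r A ->
  gram_schmidt (2 * \sum_i r i) L @[L --> A] --> A.
Proof.
move=> S0 stA; rewrite -[X in _ --> X](gram_schmidt_id S0 stA).
have [czz cww ez ew] := ortho_gt0_near S0 stA.
have [_ _ cre cim] := continuous_forms [set: 'I_n]%SET.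
have S2 : Num.sqrt (2 * \sum_i r i) != 0 by rewrite gt_eqF// sqrtr_gt0 mulr_gt0.
have coef (f : cplane R n -> R) : {for A, continuous f} -> f A = 2 * \sum_i r i ->
    {for A, continuous (fun L => Num.sqrt (2 * \sum_i r i) / Num.sqrt (f L))}.
  move=> cf ef; apply: continuousM; first exact: cst_continuous.
  apply: continuousV; first by rewrite ef.
  by apply: continuous_comp; [exact: cf|exact: sqrt_continuous].
have ca := coef _ czz ez; have cb := coef _ cww ew.
have cN (f : cplane R n -> R) : {for A, continuous f} ->
    {for A, continuous (fun L => - f L)}.
  by move=> cf; exact: continuousN.
have cz (f : cplane R n -> R) : continuous f -> {for A, continuous (fun L =>
    - (Num.sqrt (2 * \sum_i r i) / Num.sqrt (ortho_ww L)) * (f L / ortho_zz L))}.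
  move=> cf; apply: continuousM; first exact: cN cb.
  apply: continuousM; first exact: cf.
  by apply: continuousV => //; rewrite ez gt_eqF// mulr_gt0.
have cc := cz _ cre; have cd := cz _ cim.
have re i j : {for A, continuous (fun L : cplane R n => L.1 i j)} by exact: continuous_re.
have im i j : {for A, continuous (fun L : cplane R n => L.2 i j)} by exact: continuous_im.
apply: cvg_cplane => i [[|[|//]] hj]; rewrite /gram_schmidt /triu mxE /=;
  under eq_fun do rewrite mxE /=.
- by apply: (continuousM ca).
- apply: (@continuousB _ _ _ (fun L => _ + _)); last exact: (continuousM cd).
  by apply: continuousD; [exact: (continuousM cb)|exact: (continuousM cc)].
- by apply: (continuousM ca).
- apply: (@continuousD _ _ _ (fun L => _ + _)); last exact: (continuousM cd).
  by apply: continuousD; [exact: (continuousM cb)|exact: (continuousM cc)].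
Qed.

(** Complementary sets are excluded: in a closed polygon their chords are opposite, hence always
    parallel. *)
Definition apart I J := [&& (0 < #|I|)%N, (0 < #|J|)%N, [disjoint I & J]%B &
  I :|: J != [set: 'I_n]%SET].

(** The row [(1, 0)] is placed in [I], [(0, 1)] in [J], [(1, 1)] outside both, and zero elsewhere.
    The array rows are then [1, 0, 0], then [0, 0, 1], then [2, 1, 2]. The witness may lie outside
    [stiefel]. *)
Lemma gram_minor_witness I J : apart I J -> exists L, gram_minor I J L = -1.
Proof.
move=> /and4P[/card_gt0P[i0 iI] /card_gt0P[j0 jJ] dIJ].
rewrite -finset.subTset => /fintype.subsetPn[k0 _]; rewrite inE negb_or => /andP[kI kJ].
have jI : j0 \notin I by rewrite (disjointFl dIJ jJ).
have iJ : i0 \notin J by rewrite (disjointFr dIJ iI).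
have ik : i0 != k0 by apply: contraNneq kI => <-.
have jk : j0 != k0 by apply: contraNneq kJ => <-.
have ij : i0 != j0 by apply: contraNneq jI => <-.
pose a (i : 'I_n) : R := (i == i0)%:R + (i == k0)%:R.
pose b (i : 'I_n) : R := (i == j0)%:R + (i == k0)%:R.
pose L : cplane R n := (\matrix_(i, j) [:: a i; b i]`_j, 0).
have ind (K : {set 'I_n}) x : \sum_(i in K) (i == x)%:R = (x \in K)%:R :> R.
  have [xK|xK] := boolP (x \in K).
    by rewrite (bigD1 x)//= eqxx big1 ?addr0// => i /andP[_ /negPf ->].
  by apply: big1 => i iK; case: eqP => // ix; rewrite -ix iK in xK.
have zzL K : zz K L = (i0 \in K)%:R + (k0 \in K)%:R.
  rewrite -!ind -big_split; apply: eq_bigr => i _; rewrite !mxE /= expr0n addr0 /a.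
  by have [->|_] := eqVneq i i0; [rewrite (negPf ik)|have [_|_] := eqVneq i k0];
    rewrite !(addr0, add0r, expr1n, expr0n).
have wwL K : ww K L = (j0 \in K)%:R + (k0 \in K)%:R.
  rewrite -!ind -big_split; apply: eq_bigr => i _; rewrite !mxE /= expr0n addr0 /b.
  by have [->|_] := eqVneq i j0; [rewrite (negPf jk)|have [_|_] := eqVneq i k0];
    rewrite !(addr0, add0r, expr1n, expr0n).
have zwL K : zw_re K L = (k0 \in K)%:R.
  rewrite -!ind; apply: eq_bigr => i _; rewrite !mxE /= mul0r addr0 /a /b.
  have [->|ni] := eqVneq i i0; first by rewrite (negPf ik) (negPf ij) !addr0 mulr0.
  have [->|_] := eqVneq i j0; first by rewrite (negPf jk) !addr0 mul0r.
  by rewrite !add0r; case: eqP; rewrite ?mulr1 ?mulr0.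
exists L; rewrite /gram_minor !zzL !wwL !zwL !inE iI jJ.
by rewrite (negPf kI) (negPf kJ) (negPf jI) (negPf iJ) /det3 /=; ring.
Qed.

(* Along the segment from [A] to a witness, the minor is a polynomial that is not
   identically zero; the segment is brought back to [stiefel] by Gram-Schmidt. *)
Lemma perturb_chords r A (O : set (cplane R n)) I J : 0 < \sum_i r i ->
  stiefel r A -> nbhs A O -> apart I J ->
  exists B, [/\ stiefel r B, O B & cross (chord I B) (chord J B) != 0].
Proof.
move=> S0 stA AO /gram_minor_witness[W mW].
pose P : 'M[{poly R}]_(n, 2) * 'M[{poly R}]_(n, 2) :=
  (\matrix_(i, j) ((A.1 i j)%:P + 'X * (W.1 i j - A.1 i j)%:P),
   \matrix_(i, j) ((A.2 i j)%:P + 'X * (W.2 i j - A.2 i j)%:P)).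
pose L (t : R) := A + t *: (W - A).
have minorE t : (gram_minor I J P).[t] = gram_minor I J (L t).
  have -> : (gram_minor I J P).[t] = horner_eval t (gram_minor I J P) by [].
  rewrite gram_minor_morph; congr gram_minor; apply/eqP; apply/andP.
  by split; apply/eqP/matrixP => i j; rewrite !mxE /= /horner_eval !hornerE.
have p0 : gram_minor I J P != 0.
  have L1 : L 1 = W by rewrite /L scale1r addrC subrK.
  apply: contraTneq isT => p0; have := minorE 1.
  by rewrite p0 horner0 L1 mW => /eqP; rewrite eq_sym oppr_eq0 oner_eq0.
have line (a w : R) : a + t * w @[t --> (0 : R)] --> a.
  have c : {for 0, continuous (fun t : R => a + t * w)}.
    apply: continuousD; first exact: cst_continuous.
    by apply: continuousM; [exact: cvg_id|exact: cst_continuous].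
  by move: c; rewrite /prop_for /continuous_at mul0r addr0.
have LA : L t @[t --> (0 : R)^'] --> A.
  apply: cvg_within_filter; apply: cvg_cplane => i j.
    rewrite (_ : (fun t => _) = fun t => A.1 i j + t * (W.1 i j - A.1 i j)); first exact: line.
    by apply/funext => t; rewrite !mxE.
  rewrite (_ : (fun t => _) = fun t => A.2 i j + t * (W.2 i j - A.2 i j)); first exact: line.
  by apply/funext => t; rewrite !mxE.
have [czz cww ez ew] := ortho_gt0_near S0 stA.
have S2 : 0 < 2 * \sum_i r i by rewrite mulr_gt0.
have near_gt0 (f : cplane R n -> R) : {for A, continuous f} -> 0 < f A ->
    \forall B \near A, 0 < f B.
  move=> cf fA; have fA' : f B @[B --> A] --> f A := cf.
  apply: (fA' [set x | 0 < x]); apply: open_nbhs_nbhs.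
  by split; [exact: open_gt|].
have near_zz : \forall B \near A, 0 < ortho_zz B by apply: near_gt0; rewrite ?ez.
have near_ww : \forall B \near A, 0 < ortho_ww B by apply: near_gt0; rewrite ?ew.
have near_O : \forall B \near A, O (gram_schmidt (2 * \sum_i r i) B).
  exact: gram_schmidt_cvg.
near (0 : R)^' => t.
have z0 : 0 < ortho_zz (L t) by near: t; exact: LA near_zz.
have w0 : 0 < ortho_ww (L t) by near: t; exact: LA near_ww.
have stB := gram_schmidt_stiefel S0 z0 w0.
exists (gram_schmidt (2 * \sum_i r i) (L t)); split=> //.
  by near: t; exact: LA near_O.
have S2' : Num.sqrt (2 * \sum_i r i) != 0 by rewrite gt_eqF// sqrtr_gt0.
apply: cross_chord_triu stB _.
- by rewrite mulf_neq0// invr_eq0 gt_eqF// sqrtr_gt0.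
- by rewrite mulf_neq0// invr_eq0 gt_eqF// sqrtr_gt0.
- by rewrite -minorE; near: t; exact: near0_horner_neq0.
Unshelve. all: by end_near. Qed.

(** All pairs are asked for, so the set is the same for every triangulation and covers the single
    edges and the complements within the root. *)
Definition generic A := forall I J, apart I J -> cross (chord I A) (chord J A) != 0.

Lemma dot_cross_cross (u v : 'rV[R]_3) :
  dot (cross u v) (cross u v) = dot u u * dot v v - dot u v ^+ 2.
Proof. by rewrite !dotE !mxE /=; ring. Qed.

(** Lagrange's identity expresses the squared norm of the cross product by inner products of chords,
    which are already known to be continuous. *)
Lemma open_cross_neq0 I J : open [set A : cplane R n | cross (chord I A) (chord J A) != 0].
Proof.
pose F A := dot (chord I A) (chord I A) * dot (chord J A) (chord J A) -
  dot (chord I A) (chord J A) * dot (chord I A) (chord J A).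
rewrite (_ : [set A | _] = F @^-1` [set x | x != 0]).
  apply: open_comp; last exact: open_neq.
  have c K K' : continuous (fun A : cplane R n => dot (chord K A) (chord K' A)).
    by move=> A; exact: (Ck_continuous (Ck_dot_chord 0 K K' openT)).
  move=> A _.
  exact: (continuousB (continuousM (c I I A) (c J J A)) (continuousM (c I J A) (c I J A))).
apply/seteqP; split=> A /=; rewrite /F -expr2 -dot_cross_cross.
  by move=> /dot_gt0; rewrite lt0r => /andP[].
by apply: contra_neq => ->; rewrite dot0l.
Qed.

Lemma open_generic : open [set A : cplane R n | generic A].
Proof.
rewrite openE => A gA; pose good I J B := apart I J -> cross (chord I B) (chord J B) != 0.
suff H I J : \forall B \near A, good I J B.
  exact: (@filter_forall _ _ _ _ _ (fun I => @filter_forall _ _ _ _ _ (H I))).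
have [aIJ|naIJ] := boolP (apart I J); last first.
  by apply: filterS filterT => B _; rewrite /good (negPf naIJ).
apply: filterS (open_nbhs_nbhs (conj (@open_cross_neq0 I J) (gA I J aIJ))) => B.
by move=> cB _.
Qed.

(** The finitely many pairs are treated one at a time, each perturbation being so small that the
    pairs already treated stay non-parallel. *)
Lemma generic_dense r A (O : set (cplane R n)) : 0 < \sum_i r i ->
  stiefel r A -> nbhs A O -> exists B, [/\ stiefel r B, O B & generic B].
Proof.
move=> S0 stA AO; have [N [No NA] ON] : exists2 N : set (cplane R n),
  open_nbhs A N & N `<=` O by move: AO; rewrite nbhsE.
pose P : finType := ({set 'I_n} * {set 'I_n})%type.
pose good (K : P) B := apart K.1 K.2 -> cross (chord K.1 B) (chord K.2 B) != 0.
suff [B [stB OB gB]] : exists B, [/\ stiefel r B, N B & forall K, K \in enum P -> good K B].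
  exists B; split=> //; first exact: ON.
  by move=> I J; apply: (gB (I, J)); rewrite mem_enum.
elim: (enum _) => [|K s [B [stB OB gB]]]; first by exists A.
have [aK|naK] := boolP (apart K.1 K.2); last first.
  by exists B; split=> // K'; rewrite inE => /predU1P[->|]; [rewrite /good (negPf naK)|exact: gB].
have nO : nbhs B (N `&` [set B' | forall K, K \in s -> good K B']).
  apply: filterI; first exact: open_nbhs_nbhs.
  suff H K' : \forall B' \near B, K' \in s -> good K' B' by exact: (@filter_forall _ _ _ _ _ H).
  have [Ks|Ks] := boolP (K' \in s); last first.
    by apply: filterS filterT => B' _ Ks'; case/negP: Ks.
  have [aK'|naK'] := boolP (apart K'.1 K'.2); last first.
    by apply: filterS filterT => B' _ _; rewrite /good (negPf naK').
  apply: filterS (open_nbhs_nbhs (conj (@open_cross_neq0 K'.1 K'.2) (gB K' Ks aK'))) => B'.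
  by move=> cB _ _.
have [B' [stB' [OB' gB'] cB']] := perturb_chords S0 stB nO aK.
by exists B'; split=> // K'; rewrite inE => /predU1P[-> _//|]; exact: gB'.
Qed.

End Perturbation.

(** * Invariance under U(2) and under the torus *)

Section Invariance.
Context {R : realType} {n : nat}.
Implicit Types (A B : cplane R n) (r : 'I_n -> R).

Local Open Scope sesquilinear_scope.

(** Edges turn under the right action of U(2), but this matrix is fixed; whatever it determines is
    well defined on [Gr]. *)
Definition gram A : 'M[R[i]]_n := cmx A *m (cmx A)^t*.

Lemma gramE A i j : gram A i j =
  ((A.1 i 0 * A.1 j 0 + A.2 i 0 * A.2 j 0 + (A.1 i 1 * A.1 j 1 + A.2 i 1 * A.2 j 1)) +i*
   (A.2 i 0 * A.1 j 0 - A.1 i 0 * A.2 j 0 + (A.2 i 1 * A.1 j 1 - A.1 i 1 * A.2 j 1)))%C.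
Proof.
rewrite mxE sum_ord2 !mxE /=; apply/eqP; rewrite eq_complex /=.
by apply/andP; split; apply/eqP; ring.
Qed.

Lemma muT_gram A i : muT A i = complex.Re (gram A i i) / 2.
Proof. by rewrite gramE muTE. Qed.

(** For the rank-one Hermitian matrices of two rows, the trace of the product is the squared modulus
    of the Gram entry. Removing the traces leaves 8 times the inner product of the edges. *)
Lemma dot_edge_gram A i j : dot (edge A i) (edge A j) =
  (2 * sqmod (gram A i j) - complex.Re (gram A i i) * complex.Re (gram A j j)) / 16.
Proof. by rewrite !gramE !edgeE dotE !vec3E /sqmod /=; field. Qed.

Lemma dot_chord_gram A B (I J : {set 'I_n}) : gram A = gram B ->
  dot (chord I A) (chord J A) = dot (chord I B) (chord J B).
Proof.
move=> e; rewrite !dot_suml; apply: eq_bigr => i _; rewrite !dot_sumr.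
by apply: eq_bigr => j _; rewrite !dot_edge_gram e.
Qed.

Lemma enorm_chord_gram A B (I : {set 'I_n}) : gram A = gram B ->
  enorm (chord I A) = enorm (chord I B).
Proof. by move=> e; rewrite !enormE (dot_chord_gram _ _ e). Qed.

Lemma generic_gram A B : gram A = gram B -> generic A -> generic B.
Proof.
move=> e gA I J aIJ; have := dot_gt0 (gA I J aIJ); rewrite dot_cross_cross.
rewrite !(dot_chord_gram _ _ e) -dot_cross_cross.
by apply: contraTneq => ->; rewrite dot0l ltxx.
Qed.

Lemma U2_equiv_gram r (A B : stiefel r) : U2_equiv A B -> gram (val A) = gram (val B).
Proof.
move=> [g /unitarymxP gu e]; rewrite /gram e trmx_mul map_mxM /=.
by rewrite mulmxA -(mulmxA (cmx (val A))) gu mulmx1.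
Qed.

Lemma edge_T_equiv r (A B : stiefel r) i : T_equiv A B -> edge (val B) i = edge (val A) i.
Proof.
move=> [t [t1 e]]; have t2 : complex.Re (t 0 i) ^+ 2 + complex.Im (t 0 i) ^+ 2 = 1.
  by have := add_Re2_Im2 (t 0 i); rewrite t1 expr1n => -[].
have eB j : cmx (val B) i j = t 0 i * cmx (val A) i j.
  by rewrite e mul_diag_mx mxE.
have := (eB 0, eB 1); rewrite /cmx !mxE; case: (t 0 i) t2 => c s /= t2.
case=> -[e1 e2] [e3 e4]; rewrite !edgeE e1 e2 e3 e4.
(* Writing 1 as the squared modulus of the phase makes the claim a polynomial identity. *)
rewrite -[RHS]scale1r -[X in X *: _]t2.
by apply: eq_vec3; rewrite !mxE /=; field.
Qed.

End Invariance.

(** * The system on [Gr] and its integrability *)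

Section IntegrableSystem.
Context {R : realType} {n m : nat}.
Variables (r : 'I_n -> R) (C : 'I_m -> {set 'I_n}).
Implicit Types (A B : stiefel r) (k : 'I_(m + n.-1)).

(** [widen_ord] skips the last moment, which the others determine on [stiefel], where the sum of all
    is fixed. *)
Definition coordF k : cplane R n -> R :=
  match fintype.split k with
  | inl a => fun X => enorm (chord (C a) X)
  | inr i => fun X => muT X (widen_ord (leq_pred n) i)
  end.

Definition Psi (p : Gr r) : 'rV[R]_(m + n.-1) := \row_k coordF k (val (repr p)).

Lemma coordF_l a : coordF (lshift _ a) = fun X => enorm (chord (C a) X).
Proof. by rewrite /coordF (unsplitK (inl a)). Qed.

Lemma coordF_r i : coordF (rshift _ i) = fun X => muT X (widen_ord (leq_pred n) i).
Proof. by rewrite /coordF (unsplitK (inr i)). Qed.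

Lemma coordF_gram k (A B : cplane R n) : gram A = gram B -> coordF k A = coordF k B.
Proof.
move=> e; rewrite /coordF; case: fintype.split => [a|i]; first exact: enorm_chord_gram.
by rewrite !muT_gram e.
Qed.

Lemma Grpi_eq A B : Grpi A = Grpi B -> gram (val A) = gram (val B).
Proof. by move=> /eqmodP/asboolP; exact: U2_equiv_gram. Qed.

Lemma gram_repr A : gram (val (repr (Grpi A))) = gram (val A).
Proof. by apply: Grpi_eq; rewrite /Grpi reprK. Qed.

Lemma PsiE A k : Psi (Grpi A) 0 k = coordF k (val A).
Proof. by rewrite mxE; apply: coordF_gram; exact: gram_repr. Qed.

Definition generic_Gr : set (Gr r) := [set p | generic (val (repr p))].

Lemma generic_GrE A : generic_Gr (Grpi A) <-> generic (val A).
Proof. by split; apply: generic_gram; rewrite gram_repr. Qed.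

Lemma val_stiefel_continuous : continuous (fun A => val A).
Proof. exact: initial_continuous. Qed.

Lemma coordF_continuous k : continuous (coordF k).
Proof.
rewrite /coordF; case: fintype.split => [a|i] A; last exact: (Ck_muT 0 _ openT).
under eq_fun do rewrite enormE.
apply: (@continuous_comp _ _ _ (fun X => dot (chord (C a) X) (chord (C a) X)) (@Num.sqrt R)).
  exact: (Ck_dot_chord 0 _ _ openT).
exact: sqrt_continuous.
Qed.

Lemma Psi_continuous : continuous Psi.
Proof.
move=> p; apply: (cvg_mx (nbhs_filter p)) => i k.
have -> : (fun p => Psi p i k) = (fun A => coordF k (val A)) \o repr.
  by apply/funext => q; rewrite mxE.
rewrite ord1 [X in _ --> X]mxE.
suff : continuous ((fun A => coordF k (val A)) \o repr : Gr r -> R) by apply.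
apply: repr_comp_continuous.
  move=> A; apply: continuous_comp; first exact: val_stiefel_continuous.
  exact: coordF_continuous.
by move=> A B /eqP/Grpi_eq e; apply/eqP; exact: coordF_gram.
Qed.

Lemma open_generic_Gr : open generic_Gr.
Proof.
suff : open (@Grpi _ _ r @^-1` generic_Gr) by [].
have -> : @Grpi _ _ r @^-1` generic_Gr = (fun A => val A) @^-1` [set X : cplane R n | generic X].
  by apply/funext => A; apply/propext; exact: generic_GrE.
apply: open_comp open_generic => A _; exact: val_stiefel_continuous.
Qed.

Lemma dense_generic_Gr : 0 < \sum_i r i -> dense generic_Gr.
Proof.
move=> r0 W [p Wp] Wo.
(* Unfolding the quotient and subspace topologies gives a set [N] open among all matrices, whose
   trace on [stiefel] is the preimage of [W]. *)
have [N No NW] : open (@Grpi _ _ r @^-1` W) := Wo.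
have pE : Grpi (repr p) = p by rewrite /Grpi reprK.
have Np : N (val (repr p)).
  have : ((fun A => val A) @^-1` N) (repr p) by rewrite NW /preimage /= pE.
  by [].
have [B [stB NB gB]] := generic_dense r0 (set_mem (valP (repr p)))
  (open_nbhs_nbhs (conj No Np)).
pose B' : stiefel r := exist _ B (mem_set stB).
exists (Grpi B'); split; first by have : ((fun A => val A) @^-1` N) B' by []; rewrite NW.
exact/generic_GrE.
Qed.

Hypothesis C_apart : forall a, exists J, apart (C a) J.

Lemma generic_chord_neq0 a (A : cplane R n) : generic A -> chord (C a) A != 0.
Proof.
by have [J aJ] := C_apart a; move=> /(_ _ _ aJ); apply: contra_neq => ->; rewrite cross0l.
Qed.

Lemma local_lift_coordF k A : generic (val A) ->
  local_lift (fun p => Psi p 0 k) A (coordF k).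
Proof.
move=> gA; rewrite /coordF; case: (split_ordP k) => [a ->|i ->].
  exists [set X : cplane R n | chord (C a) X != 0]; split.
  - exact: open_chord_neq0.
  - exact: generic_chord_neq0.
  - exact: smooth_enorm_chord.
  - by move=> B _; rewrite PsiE coordF_l.
exists setT; split=> //; first exact: openT.
  by move=> l; apply: Ck_muT; exact: openT.
by move=> B _; rewrite PsiE coordF_r.
Qed.

Definition hamF k : cplane R n -> cplane R n :=
  match fintype.split k with
  | inl a => bend_field (C a)
  | inr i => phase_field (widen_ord (leq_pred n) i)
  end.

Lemma hamF_l a : hamF (lshift _ a) = bend_field (C a).
Proof. by rewrite /hamF (unsplitK (inl a)). Qed.

Lemma hamF_r i : hamF (rshift _ i) = phase_field (widen_ord (leq_pred n) i).
Proof. by rewrite /hamF (unsplitK (inr i)). Qed.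

Lemma sympl_hamF k (A V : cplane R n) : generic A ->
  sympl (hamF k A) V = 'D_V (coordF k) A.
Proof.
move=> gA; rewrite /hamF /coordF; case: fintype.split => [a|i].
  by apply: sympl_bend_field; exact: generic_chord_neq0.
exact: sympl_phase_field.
Qed.

Lemma tangent_hamF k (A : cplane R n) : tangent A (hamF k A).
Proof.
by rewrite /hamF; case: fintype.split => [a|i];
  [exact: tangent_bend_field|exact: tangent_phase_field].
Qed.

Hypothesis C_laminar : forall a b,
  [\/ C a \subset C b, C b \subset C a | [disjoint C a & C b]%B].

Lemma sympl_hamF_hamF j k (A : cplane R n) : sympl (hamF j A) (hamF k A) = 0.
Proof.
rewrite /hamF; case: (fintype.split j) (fintype.split k) => [a|i] [b|l].
- exact: sympl_bend_bend.
- exact: sympl_phase_r.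
- exact: sympl_phase_l.
- exact: sympl_phase_l.
Qed.

Hypothesis C_inj : injective C.
Hypothesis C_gt1 : forall a, (1 < #|C a|)%N.
Variable root : {set 'I_n}.
Hypothesis C_root : forall a, C a \proper root.
Hypothesis root_gt1 : (1 < #|root|)%N.
Variable last : 'I_n.
Hypothesis last_val : last.+1 = n.
Hypothesis last_root : last \notin root.

(** A partner [j] apart from [i] requires a third side outside both. Two elements of [root] and
    [last] provide three sides, and the choice depends on whether [i] is [last]. *)
Lemma generic_edge_neq0 (A : cplane R n) i : generic A -> edge A i != 0.
Proof.
move=> gA; have chord1 : chord [set i]%SET A = edge A i by rewrite /chord big_set1.
suff [j ij] : exists j, apart [set i]%SET [set j]%SET.
  by rewrite -chord1; apply: contra_neq (gA _ _ ij) => ->; rewrite cross0l.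
have [l lr li] : exists2 l, l \in root & l != i.
  have /finset.set0Pn[l] : root :\ i != finset.set0.
    rewrite -card_gt0; have := root_gt1; rewrite (cardsD1 i).
    by case: (i \in root) => //= /ltnW.
  by rewrite !inE => /andP[li lr]; exists l.
have lastl : last != l by apply: contraNneq last_root => ->.
have [il|il] := eqVneq i last.
  exists l; rewrite /apart !cards1 finset.disjoints1 inE eq_sym li /=.
  have [x xr] : exists2 x, x \in root & x != l.
    have /finset.set0Pn[x] : root :\ l != finset.set0.
      rewrite -card_gt0; have := root_gt1; rewrite (cardsD1 l).
      by case: (l \in root) => //= /ltnW.
    by rewrite !inE => /andP[xl xr]; exists x.
  move=> xl; apply: contraNneq xl => /finset.setP/(_ x).
  rewrite !inE => /orP[/eqP xi|//]; move: last_root; rewrite -il -xi xr.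
  by [].
exists last; rewrite /apart !cards1 finset.disjoints1 inE il /=.
apply: contraNneq li => /finset.setP/(_ l).
by rewrite !inE [l == last]eq_sym (negPf lastl) orbF.
Qed.

(** A relation yields a row rotation with phases [h] and axes [v] that, after removal of a common
    [h0] and [w], fixes every row. The axes determine the coefficients of the lengths through the
    laminar family; the phases then determine those of the moments. *)
Lemma independent_generic A : 0 < \sum_i r i -> generic (val A) ->
  independent_at (fun k p => Psi p 0 k) A.
Proof.
move=> r0 gA; exists coordF; split=> [k|c indep]; first exact: local_lift_coordF.
have stA : stiefel r (val A) := set_mem (valP A).
set X := val A in gA indep stA.
pose h (i : 'I_n) := \sum_(j < n.-1) c (rshift m j) * (i == widen_ord (leq_pred n) j)%:R.
pose v i := \sum_a c (lshift n.-1 a) *: bend_coef (C a) X i.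
have symplE V : sympl (row_rot h v X) V = \sum_k c k * sympl (hamF k X) V.
  rewrite big_split_ord /= sympl_row_rot.
  transitivity (\sum_a \sum_i c (lshift n.-1 a) * dot (bend_coef (C a) X i) (dedge X V i) +
      \sum_(j < n.-1) \sum_i
        c (rshift m j) * (i == widen_ord (leq_pred n) j)%:R * dmuT X V i).
    rewrite exchange_big [X in _ + X]exchange_big -big_split; apply: eq_bigr => i _ /=.
    rewrite addrC /h /v mulr_suml dot_suml; congr (_ + _); apply: eq_bigr => a _.
    by rewrite dotZl.
  congr (_ + _); apply: eq_bigr => a _.
    rewrite hamF_l sympl_row_rot mulr_sumr; apply: eq_bigr => i _.
    by rewrite mul0r add0r.
  rewrite hamF_r sympl_row_rot mulr_sumr; apply: eq_bigr => i _.
  by rewrite dot0l addr0 mulrA.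
have [h0 [w rot0]] : exists h0 w, row_rot (fun i => h i - h0) (fun i => v i - w) X = 0.
  apply: (sympl_row_rot_tangent stA); first by rewrite gt_eqF.
  move=> V tV; rewrite symplE -[RHS](indep V tV).
  by apply: eq_bigr => k _; rewrite sympl_hamF.
(* The fields use unit axes, whereas the laminar lemma uses the chords themselves. *)
pose c' a := c (lshift n.-1 a) / enorm (chord (C a) X).
have [c'0 w0] : (forall a, c' a = 0) /\ w = 0.
  apply: (@laminar_coef_eq0 _ _ _ C root (edge X)) => //.
    move=> I J I0 J0 dIJ IJr; apply: gA; apply/and4P; split=> //.
    by apply: contraTneq last_root => IJT; apply/negPn/(fintype.subsetP IJr); rewrite IJT inE.
  move=> i; rewrite crossC -[RHS]oppr0; congr (- _).
  rewrite -[RHS](row_rot_eq0 i rot0); congr (cross _ (_ - _)).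
  rewrite /v [LHS]big_mkcond; apply: eq_bigr => a _; rewrite /bend_coef /c'.
  by case: ifP => _; rewrite ?scaler0// scalerA.
have cl a : c (lshift n.-1 a) = 0.
  have /eqP := c'0 a; rewrite mulf_eq0 invr_eq0 => /orP[/eqP //|].
  by rewrite gt_eqF// enorm_gt0// generic_chord_neq0.
have v0 i : v i = 0 by apply: big1 => a _; rewrite cl scale0r.
have hk i : h i = h0.
  apply/eqP; rewrite -subr_eq0; apply/eqP.
  apply: (row_rot_eq0_coef rot0); first by rewrite v0 w0 subrr.
  exact: generic_edge_neq0.
(* All phases equal [h0], and the phase of the last row is zero because its moment is not in the
   system. *)
have h00 : h0 = 0.
  rewrite -(hk last); apply: big1 => j _; case: eqP => [e|_]; last by rewrite mulr0.
  by have := ltn_ord j; rewrite -[val j]/(val (widen_ord (leq_pred n) j)) -e -ltnS last_val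
    prednK ?ltnn// -last_val.
move=> k; case: (split_ordP k) => [a ->//|j ->].
have := hk (widen_ord (leq_pred n) j); rewrite h00 /h (bigD1 j)//= eqxx mulr1.
rewrite big1 ?addr0// => l lj; case: eqP => [e|_]; last by rewrite mulr0.
case/eqP: lj; apply: val_inj; exact: (congr1 val (esym e)).
Qed.

Lemma Psi_completely_integrable : 0 < \sum_i r i -> completely_integrable Psi.
Proof.
move=> r0; split; first exact: Psi_continuous.
exists generic_Gr; split.
- exact: open_generic_Gr.
- exact: dense_generic_Gr.
- by move=> k A /generic_GrE gA; exists (coordF k); exact: local_lift_coordF.
- move=> j k A /generic_GrE gA.
  exists (coordF j), (coordF k), (hamF j (val A)), (hamF k (val A)).
  split; [exact: local_lift_coordF|exact: local_lift_coordF| | |].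
  + by split=> [|V _]; [exact: tangent_hamF|exact: sympl_hamF].
  + by split=> [|V _]; [exact: tangent_hamF|exact: sympl_hamF].
  + by rewrite sympl_hamF_hamF.
- exists generic_Gr; split=> //; [exact: open_generic_Gr|exact: dense_generic_Gr|].
  by move=> A /generic_GrE; exact: independent_generic.
Qed.

End IntegrableSystem.

Lemma Psi_induces (R : realType) n m (r : 'I_n -> R) (C I : 'I_m -> {set 'I_n}) :
  (forall a, I a = C a \/ I a = ~: C a) -> induces (@Psi _ _ _ r C) I.
Proof.
move=> hI; exists (lshift n.-1); split; first exact: lshift_inj.
move=> a; split=> [A B AB|].
  rewrite !PsiE coordF_l; congr enorm; apply: eq_bigr => i _.
  by rewrite (edge_T_equiv i AB).
exists false, 0 => A hA; rewrite expr0 mul1r addr0 /polygon_of bendingE PsiE coordF_l.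
have -> : \sum_(i in I a) row i (edges (val A)) = chord (I a) (val A) by [].
case: (hI a) => -> //.
by rewrite (chordC _ (set_mem (valP A))) enormN.
Qed.

(** * Combinatorics of the side groups of diagonals *)

Section CutSides.
Variable n : nat.
Implicit Types d : 'I_n * 'I_n.

Lemma mem_cut_sides d (i : 'I_n) : (i \in cut_sides d) = (d.1 <= i < d.2)%N.
Proof. by rewrite inE. Qed.

Lemma is_diagonal_ltn d : is_diagonal d -> (d.1.+1 < d.2)%N.
Proof. by case/andP. Qed.

Lemma cut_sides_gt1 d : is_diagonal d -> (1 < #|cut_sides d|)%N.
Proof.
move=> /is_diagonal_ltn dlt.
have lt1 : (d.1.+1 < n)%N := ltn_trans dlt (ltn_ord d.2).
apply: leq_trans (_ : (1 < #|[set d.1; Ordinal lt1]%SET|)%N) (subset_leq_card _).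
  by rewrite cards2 -val_eqE /= neq_ltn ltnSn.
apply/fintype.subsetP => i; rewrite !inE => /orP[] /eqP -> /=.
  by rewrite leqnn ltnW.
by rewrite leqnSn.
Qed.

(** The group is an interval whose least element is [d.1] and whose greatest is [d.2.-1], so the
    endpoints can be recovered. *)
Lemma cut_sides_inj d d' : is_diagonal d -> is_diagonal d' ->
  cut_sides d = cut_sides d' -> d = d'.
Proof.
have half (e e' : 'I_n * 'I_n) : is_diagonal e -> is_diagonal e' -> cut_sides e = cut_sides e' ->
    (e'.1 <= e.1)%N /\ (e.2 <= e'.2)%N.
  move=> /is_diagonal_ltn elt _ ee'; have e2 : (0 < e.2)%N by apply: leq_ltn_trans elt.
  have e2n : (e.2.-1 < n)%N by rewrite (leq_ltn_trans (leq_pred _)).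
  have := mem_cut_sides e e.1; rewrite ee' mem_cut_sides leqnn (ltnW elt) => /andP[-> _].
  have := mem_cut_sides e (Ordinal e2n); rewrite ee' mem_cut_sides /= ltn_predL e2.
  have -> : (e.1 <= e.2.-1)%N by rewrite -ltnS (prednK e2) ltnW.
  move=> /andP[_].
  by rewrite prednK.
move=> hd hd' e; have [a b] := half _ _ hd hd' e; have [a' b'] := half _ _ hd' hd (esym e).
by rewrite [d]surjective_pairing [d']surjective_pairing; congr pair; apply/val_inj/eqP;
  rewrite /= eqn_leq ?a ?b ?a' ?b'.
Qed.

(** Two intervals that overlap without nesting have interleaved endpoints. *)
Lemma cut_sides_laminar d d' : ~~ crossing d d' ->
  [\/ cut_sides d \subset cut_sides d', cut_sides d' \subset cut_sides d |
      [disjoint cut_sides d & cut_sides d']%B].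
Proof.
have sub (e e' : 'I_n * 'I_n) : (e'.1 <= e.1)%N -> (e.2 <= e'.2)%N -> cut_sides e \subset cut_sides e'.
  move=> a b; apply/fintype.subsetP => i; rewrite !inE => /andP[c f].
  by rewrite (leq_trans a c) (leq_trans f b).
have dis (e e' : 'I_n * 'I_n) : (e.2 <= e'.1)%N -> [disjoint cut_sides e & cut_sides e']%B.
  move=> a; apply/fintype.pred0P => i /=; rewrite !inE.
  by apply/negbTE/negP => /andP[/andP[_ b] /andP[c _]]; have := leq_trans b (leq_trans a c);
    rewrite ltnn.
rewrite /crossing => nc.
have [h|h] := leqP d.2 d'.1; first by constructor 3; exact: dis.
have [h'|h'] := leqP d'.2 d.1; first by constructor 3; rewrite fintype.disjoint_sym; exact: dis.
rewrite h h' /= in nc.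
have [l|l] := leqP d'.1 d.1; have [u|u] := leqP d.2 d'.2.
- by constructor 1; exact: sub.
(* Diagonals with a common endpoint do not cross, and their intervals are then nested. *)
- have [e|ne] := eqVneq (d.1 : nat) d'.1.
    by constructor 2; apply: sub; [rewrite e|exact: ltnW].
  by move: nc; rewrite u [(d'.1 < d.1)%N]ltn_neqAle eq_sym ne l orbT.
- have [e|ne] := eqVneq (d.2 : nat) d'.2.
    by constructor 2; apply: sub; [exact: ltnW|rewrite e].
  by move: nc; rewrite l [(d.2 < d'.2)%N]ltn_neqAle ne u.
- by constructor 2; apply: sub; exact: ltnW.
Qed.

(** As [d.2 < n], the last side is never in the group. All the other sides together would be the
    group of the pair of vertices 0 and [n.-1], which bounds the last side and is excluded by
    [is_diagonal]. *)
Lemma cut_sides_proper d : is_diagonal d ->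
  cut_sides d \proper [set i : 'I_n | (i.+1 < n)%N]%SET.
Proof.
move=> hd; have dlt := is_diagonal_ltn hd.
apply/fintype.properP; split.
  by apply/fintype.subsetP => i; rewrite !inE => /andP[_ id]; exact: leq_ltn_trans id (ltn_ord _).
have n0 : (0 < n)%N by apply: leq_ltn_trans (ltn_ord d.1).
case/andP: (hd) => _; rewrite negb_and => /orP[d1|d2].
  exists (Ordinal n0); rewrite !inE /=.
    by apply: leq_ltn_trans (ltn_ord d.2); apply: leq_trans dlt.
  by rewrite leqn0 (negPf d1).
exists d.2; rewrite !inE; last by rewrite ltnn andbF.
by rewrite ltn_neqAle d2 ltn_ord.
Qed.

End CutSides.

Theorem theorem1p1 (R : realType) (n : nat) (hn : (3 <= n)%N) (r : 'I_n -> R)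
  (r_gt0 : forall i, 0 < r i)
  (r_lt : forall i, r i < \sum_(j | j != i) r j)
  (Gamma : triangulation n)
  (I : 'I_(n - 3) -> {set 'I_n}) (hI : side_choice Gamma I) :
  exists Psi : Gr r -> 'rV[R]_(2 * n - 4),
    completely_integrable Psi /\ induces Psi I.
Proof.
(* There are [n - 3] diagonals and [n.-1] moments, all but one. *)
have -> : (2 * n - 4 = n - 3 + n.-1)%N.
  case: n hn {r r_gt0 r_lt Gamma I hI} => [|[|[|k]]]// _.
  by rewrite mul2n -addnn !addSn !addnS !subSS !subn0.
have n0 : (n.-1 < n)%N by rewrite prednK// (leq_trans _ hn).
pose C a := cut_sides (Gamma a).
pose root := [set i : 'I_n | (i.+1 < n)%N]%SET.
have last_root : Ordinal n0 \notin root by rewrite inE /= prednK ?ltnn// (leq_trans _ hn).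
have C_root a : C a \proper root by apply: cut_sides_proper; exact: diagonalsP.
exists (@Psi _ _ _ r C); split; last by apply: Psi_induces => a; exact: hI.
apply: (@Psi_completely_integrable _ _ _ _ _ _ _ _ _ root _ _ (Ordinal n0)) => //.
(* The partner of [C a] is its complement within [root], so that the last side remains outside the
   union. *)
- move=> a; exists (root :\: C a)%SET; apply/and4P; split.
  + by rewrite ltnW// cut_sides_gt1//; exact: diagonalsP.
  + have [_ [j jr jC]] := fintype.properP (C_root a).
    by apply/card_gt0P; exists j; rewrite inE jC.
  + by rewrite finset.disjoints_subset finset.setCD finset.subsetUr.
  + apply: contraNneq last_root => /finset.setP/(_ (Ordinal n0)).
    rewrite !inE => /orP[|/andP[]//].
    by move=> h; have := fintype.subsetP (proper_sub (C_root a)) (Ordinal n0); rewrite !inE; apply.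
- by move=> a b; apply: cut_sides_laminar; exact: diagonals_noncrossing.
- move=> a b e; apply: (@diagonals_inj _ Gamma).
  by apply: cut_sides_inj e; exact: diagonalsP.
- by move=> a; apply: cut_sides_gt1; exact: diagonalsP.
- have n1 : (0 < n)%N by apply: leq_trans hn.
  have n2 : (1 < n)%N by apply: leq_trans hn.
  apply: leq_trans (_ : (1 < #|[set Ordinal n1; Ordinal n2]%SET|)%N) (subset_leq_card _).
    by rewrite cards2.
  by apply/fintype.subsetP => i; rewrite !inE => /orP[] /eqP -> /=.
- by rewrite /= prednK// (leq_trans _ hn).
- rewrite (bigD1 (Ordinal n0))//= ltr_pwDl// sumr_ge0// => i _; exact: ltW.
Qed.
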